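(* Let $\alpha>0$ and let $\Psi:\mathbb{R}^2\to\mathbb{R}$ be a real analytic scalar function invariant under spatial rotation, i.e. $\Psi'(x',y')=\Psi(x,y)$ and $L\Psi=y\,D^1_x\Psi-x\,D^1_y\Psi=0$, where $x'=\cos\phi\,x+\sin\phi\,y$, $y'=-\sin\phi\,x+\cos\phi\,y$. Let $D^\alpha$ denote the Riemann-Liouville partial fractional derivatives. Then for fixed $x,y>0$, to first order in the rotation angle $\phi$ (i.e. up to $O(\phi^2)$ as $\phi\to0$), $$D^\alpha_{x'}\Psi'(x',y')= D^\alpha_x\Psi(x,y)+\phi\left(\alpha\,D_x^{\alpha-1}D^1_y\Psi(x,y)+\frac{y\,\Psi(0,y)\,x^{-\alpha-1}}{\Gamma(-\alpha)}\right)+O(\phi^2),$$ $$D^\alpha_{y'}\Psi'(x',y')= D^\alpha_y\Psi(x,y)-\phi\left(\alpha\,D_y^{\alpha-1}D^1_x\Psi(x,y)+\frac{x\,\Psi(x,0)\,y^{-\alpha-1}}{\Gamma(-\alpha)}\right)+O(\phi^2).$$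
   Context: $D^1_x=\partial/\partial x$, $D^1_y=\partial/\partial y$. For $n-1<\alpha<n$, $n\in\mathbb{N}$, $n\ge1$, the Riemann-Liouville partial fractional derivatives with lower limit $0$ are $$D_x^\alpha f(x,y)=\frac{1}{\Gamma(n-\alpha)}\frac{\partial^n}{\partial x^n}\int_0^x\frac{f(u,y)\,du}{(x-u)^{\alpha-n+1}},\qquad D_y^\alpha f(x,y)=\frac{1}{\Gamma(n-\alpha)}\frac{\partial^n}{\partial y^n}\int_0^y\frac{f(x,u)\,du}{(y-u)^{\alpha-n+1}};$$ for a nonnegative integer order they are the ordinary partial derivatives (order $0$ is the identity). For $\alpha<0$ the symbols denote the Riemann-Liouville fractional integrals $$D_x^\alpha f(x,y)=\frac{1}{\Gamma(-\alpha)}\int_0^x\frac{f(u,y)\,du}{(x-u)^{1+\alpha}},\qquad D_y^\alpha f(x,y)=\frac{1}{\Gamma(-\alpha)}\int_0^y\frac{f(x,u)\,du}{(y-u)^{1+\alpha}}.$$ By convention $1/\Gamma(-\alpha)=0$ when $\alpha$ is a positive integer. The dependence of $\Psi$ on the rotation angle comes only through its arguments, so that $\Psi'$ as a function of its two arguments is the same function as $\Psi$, and $D^\alpha_{x'}\Psi'(x',y')$ (resp. $D^\alpha_{y'}\Psi'(x',y')$) is the fractional derivative of $\Psi'$ in its first (resp. second) argument, evaluated at $(x',y')$. *)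

(* Defs.v *)
(* MathComp-Analysis, over an arbitrary R : realType. *)
From HB Require Import structures.
From mathcomp Require Import all_boot all_order all_algebra.
From mathcomp Require Import all_classical all_reals all_analysis.

Set Implicit Arguments.
Unset Strict Implicit.
Unset Printing Implicit Defensive.

Import Order.TTheory GRing.Theory Num.Theory.
Import numFieldNormedType.Exports.

Local Open Scope classical_set_scope.
Local Open Scope ring_scope.

(* Euler's integral, meaningful for z > 0. *)
Definition Euler_gamma (R : realType) (z : R) : R :=
  \int[@lebesgue_measure R]_(t in `]0, +oo[) (t `^ (z - 1) * expR (- t)).

(* For z <= 0, m is the least natural number with z + m > 0, and Gamma is
   extended by Gamma (z + m) = z (z + 1) ... (z + m - 1) Gamma z.  At a pole
   (z = 0, -1, -2, ...) the denominator vanishes, hence Gamma z = 0 and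
   (Gamma z)^-1 = 0, which is the convention 1 / Gamma z = 0. *)
Definition Gamma (R : realType) (z : R) : R :=
  if 0 < z then Euler_gamma z
  else let m := (Num.truncn (- z)).+1 in
       Euler_gamma (z + m%:R) / \prod_(k < m) (z + k%:R).

(* Used for x >= 0 only; a Lebesgue integral, so the value of the integrand at
   the singular endpoint u = x is irrelevant. *)
Definition RL_integral (R : realType) (b : R) (f : R -> R) (x : R) : R :=
  \int[@lebesgue_measure R]_(u in `[0, x]) (f u / (x - u) `^ b).

(* Riemann-Liouville differintegral of real order a with lower limit 0. In the
   last case a is positive and not an integer, and n - 1 < a < n. *)
Definition RL_deriv (R : realType) (a : R) (f : R -> R) (x : R) : R :=
  if a < 0 then (Gamma (- a))^-1 * RL_integral (1 + a) f x
  else if a \is a Num.nat then derive1n (Num.truncn a) f x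
  else let n := (Num.truncn a).+1 in
       (Gamma (n%:R - a))^-1 * derive1n n (RL_integral (a - n%:R + 1) f) x.

Definition RL_deriv_x (R : realType) (a : R) (f : R -> R -> R) (x y : R) : R :=
  RL_deriv a (fun u => f u y) x.

Definition RL_deriv_y (R : realType) (a : R) (f : R -> R -> R) (x y : R) : R :=
  RL_deriv a (fun u => f x u) y.

Definition partial_x (R : realType) (f : R -> R -> R) (x y : R) : R :=
  derive1 (fun u => f u y) x.

Definition partial_y (R : realType) (f : R -> R -> R) (x y : R) : R :=
  derive1 (fun u => f x u) y.

(* Around every point, f is the sum of an absolutely convergent double power
   series; absolute convergence makes the choice of square partial sums
   immaterial. *)
Definition real_analytic2 (R : realType) (f : R -> R -> R) : Prop :=
  forall a b : R, exists (c : nat -> nat -> R) (r : R), 0 < r /\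
    forall x y : R, `|x - a| < r -> `|y - b| < r ->
      let t i j := c i j * (x - a) ^+ i * (y - b) ^+ j in
      summable [set: nat * nat] (fun ij => (t ij.1 ij.2)%:E) /\
      (\sum_(i < N) \sum_(j < N) t i j) @[N --> \oo] --> f x y.

Definition rot_x (R : realType) (phi x y : R) : R := cos phi * x + sin phi * y.

Definition rot_y (R : realType) (phi x y : R) : R :=
  - sin phi * x + cos phi * y.

Definition rotation_invariant (R : realType) (f : R -> R -> R) : Prop :=
  (forall phi x y : R, f (rot_x phi x y) (rot_y phi x y) = f x y) /\
  (forall x y : R, y * partial_x f x y - x * partial_y f x y = 0).

(* Main.v *)
(* A rotation invariant Psi is symmetric, so the second expansion follows from
   the first one at (y, x) with phi replaced by - phi. For the first one write
   Psi(u, y) = h(u^2 + y^2) with h smooth on the positive half-line. Along the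
   rotation orbit u^2 + y^2 = r^2 is constant, hence
   D^alpha_x' Psi'(x', y') = M(x'(phi)) for a function M of one variable, and it
   suffices to compute M' and to see that M' is differentiable at x.

   The substitution u = x (1 - v^g), g = 1 / (1 - b), turns the singular
   integral of f(u) / (x - u)^b over [0, x] into g x^(1 - b) times the integral
   of f(x (1 - v^g)) over [0, 1], which can be differentiated under the integral
   sign; an integration by parts then gives the boundary terms at u = 0.
   The formula for M' is a commutator identity: with z = r^2 - x^2 the total
   derivative is D_x - 2 x D_z, and D_x h(u^2 + z) = 2 u D_z h(u^2 + z), so only
   the commutators of multiplication by x with D_x^n and with the fractional
   integral survive. Together they give the factor alpha. *)
Require Import Defs.
From HB Require Import structures.
From mathcomp Require Import all_boot all_order all_algebra.
From mathcomp Require Import all_classical all_reals all_analysis.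
From mathcomp Require Import measurable_realfun ring lra.
Import Order.TTheory GRing.Theory Num.Theory.
Import numFieldNormedType.Exports.
Local Open Scope classical_set_scope.
Local Open Scope ring_scope.

Set Implicit Arguments.
Unset Strict Implicit.
Unset Printing Implicit Defensive.

(** * Smooth radial profile *)

(** Termwise differentiation costs a factor [i.+1]. For [z1 < w] strictly between [|z|] and [|K|]
    the ratio w / z1 = 1 + d exceeds 1, so the growth of (1 + d)^i absorbs it, and the series is
    dominated by the absolutely convergent one at [w]. *)
Lemma is_cvg_pseries_diffs_inside (R : realType) (c : nat -> R) (K z : R) :
  cvgn (pseries c K) -> `|z| < `|K| -> cvgn (pseries (pseries_diffs c) z).
Proof.
move=> cK zK.
pose z1 : R := (`|z| + (`|z| + `|K|) / 2) / 2.
pose w : R := (`|z| + `|K|) / 2.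
have z0 : 0 <= `|z| by [].
have z1z : `|z| < z1 by rewrite /z1; lra.
have z10 : 0 < z1 by lra.
have z1w : z1 < w by rewrite /z1 /w; lra.
have wK : w < `|K| by rewrite /w; lra.
pose d := w / z1 - 1.
have d0 : 0 < d by rewrite /d subr_gt0 ltr_pdivlMr// mul1r.
have wE : w = z1 * (1 + d) by rewrite /d addrC subrK mulrC divfK// gt_eqF.
pose m := Num.min 1 d.
have m0 : 0 < m by rewrite /m lt_min ltr01 d0.
have bern i : i.+1%:R * m <= (1 + d) ^+ i.
  elim: i => [|i IH]; first by rewrite mul1r expr0 /m ge_min lexx.
  have md : m <= d by rewrite /m ge_min lexx orbT.
  have p1 : 1 <= (1 + d) ^+ i by rewrite exprn_ege1//; lra.
  have -> : i.+2%:R = i.+1%:R + 1 :> R by rewrite natr1.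
  rewrite exprS; nra.
have key i : i.+1%:R * `|z| ^+ i <= m^-1 * w ^+ i.
  rewrite -(ler_pM2l m0) !mulrA divff ?gt_eqF// mul1r wE exprMn.
  apply: (@le_trans _ _ (z1 ^+ i * (i.+1%:R * m))); last first.
    by rewrite ler_pM2l ?exprn_gt0.
  rewrite mulrC [m * _]mulrC ler_pM2r ?mulr_gt0//.
  by rewrite lerXn2r// ?nnegrE; lra.
have cabs : cvgn (pseries (fun i => `|c i|) w).
  by apply: is_cvg_pseries_inside_norm cK _; rewrite [`|w|]ger0_norm//; lra.
apply: normed_cvg.
apply: (@series_le_cvg _ _ (fun i => (m^-1 / w) * (`|c i.+1| * w ^+ i.+1))).
- by move=> n /=.
- move=> n; rewrite !mulr_ge0// ?invr_ge0 ?exprn_ge0//; lra.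
- move=> n /=; rewrite /pseries_diffs normrM normrM normrX ger0_norm//.
  have -> : m^-1 / w * (`|c n.+1| * w ^+ n.+1) = `|c n.+1| * (m^-1 * w ^+ n).
    rewrite exprS; field; rewrite !gt_eqF//; lra.
  by rewrite mulrAC mulrC ler_wpM2l// key.
- apply: is_cvg_seriesZ.
  have : cvgn (series (fun i => `|c i| * w ^+ i)) by [].
  move=> /cvg_ex[l cl]; apply/cvg_ex => /=; exists (l - `|c 0%N| * w ^+ 0).
  rewrite [X in X @ _ --> _](_ : _ = (fun n =>
     series (fun i => `|c i| * w ^+ i) n.+1 - `|c 0%N| * w ^+ 0)).
    apply: cvgB; last exact: cvg_cst.
    by move: cl; rewrite -(cvg_shiftS (series _)).
  by apply/funext => n; rewrite /series /= big_nat_recl//= addrC addKr.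
Qed.

Definition analytic1 (R : realType) (f : R -> R) : Prop :=
  forall a : R, exists (c : nat -> R) (r : R), 0 < r /\
    forall t : R, `|t - a| < r -> pseries c (t - a) @ \oo --> f t.

(** Analyticity passes to the derivative, with coefficients [pseries_diffs c] and the same radius,
    so the step can be iterated to any order. *)
Lemma analytic1_derive (R : realType) (f : R -> R) : analytic1 f ->
  (forall t : R, is_derive t 1 f ((derive1 f) t)) /\ analytic1 (derive1 f).
Proof.
move=> af.
have key (a : R) : exists (c : nat -> R) (r : R), 0 < r /\
    forall t : R, `|t - a| < r -> is_derive t 1 f (limn (pseries (pseries_diffs c) (t - a)))
      /\ cvgn (pseries (pseries_diffs c) (t - a)).
  have [c [r [r0 cf]]] := af a; exists c, r; split; [exact: r0 | move=> t tr].
  have cv s : `|s| < r -> cvgn (pseries c s).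
    move=> sr; apply/cvg_ex => /=; exists (f (s + a)).
    by have := cf (s + a); rewrite addrK; apply.
  have tr0 : 0 <= `|t - a| by [].
  (* [pseries_snd_diffs] asks for convergence of the series and of its first two formal derivatives
     at one point beyond [t - a]. Each formal derivative costs a little radius, hence |t - a| < K1 <
     K2 < K3 < r. *)
  pose K3 : R := (`|t - a| + r) / 2.
  pose K2 : R := (`|t - a| + K3) / 2.
  pose K1 : R := (`|t - a| + K2) / 2.
  have n3 : `|K3| = K3 by rewrite ger0_norm// /K3; lra.
  have n2 : `|K2| = K2 by rewrite ger0_norm// /K2 /K3; lra.
  have n1 : `|K1| = K1 by rewrite ger0_norm// /K1 /K2 /K3; lra.
  have c3 : cvgn (pseries c K3) by apply: cv; rewrite n3 /K3; lra.
  have c2 : cvgn (pseries (pseries_diffs c) K2).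
    by apply: is_cvg_pseries_diffs_inside c3 _; rewrite n3 n2 /K2 /K3; lra.
  have c1 : cvgn (pseries (pseries_diffs (pseries_diffs c)) K1).
    by apply: is_cvg_pseries_diffs_inside c2 _; rewrite n1 n2 /K1 /K2 /K3; lra.
  have c2' : cvgn (pseries (pseries_diffs c) K1).
    by apply: is_cvg_pseries_inside c2 _; rewrite n1 n2 /K1 /K2 /K3; lra.
  have c3' : cvgn (pseries c K1).
    by apply: is_cvg_pseries_inside c3 _; rewrite n1 n3 /K1 /K2 /K3; lra.
  have ct : cvgn (pseries (pseries_diffs c) (t - a)).
    by apply: is_cvg_pseries_inside c2 _; rewrite n2 /K2 /K3; lra.
  split; last exact: ct.
  have D := @pseries_snd_diffs _ c K1 (t - a) c3' c2' c1.
  have {}D := D ltac:(rewrite n1 /K1 /K2 /K3; lra).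
  apply: (@near_eq_is_derive _ _ _ ((fun s => limn (pseries c s)) \o (fun u => u - a))).
    near=> u; apply/cvg_lim => //; apply: cf.
    near: u; have /nbhs_ballP := @nbhsx_ballx _ R^o t (r - `|t - a|) ltac:(by rewrite subr_gt0).
    move=> [e e0 be]; apply/nbhs_ballP; exists e => // u /be/=.
    rewrite /ball/= => h; rewrite (_ : u - a = (u - t) + (t - a)); last by ring.
    by rewrite (le_lt_trans (ler_normD _ _))// distrC -ltrBrDr.
  rewrite -[X in is_derive _ _ _ X]mulr1; apply: is_derive1_comp.
  by apply: is_derive_eq; rewrite subr0.
have D (t : R) : is_derive t 1 f ((derive1 f) t).
  have [c [r [r0 /(_ t)]]] := key t.
  rewrite subrr normr0 => /(_ r0)[d _].
  by rewrite derive1E; apply: derivableP; exact: ex_derive.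
split => // a.
have [c [r [r0 H]]] := key a; exists (pseries_diffs c), r; split; [exact: r0 | move=> t tr].
have [d cv] := H _ tr; rewrite derive1E derive_val.
exact: cv.
Unshelve. all: by end_near. Qed.

(** The derivative is an existential witness, so that sum, product and chain rules only have to
    exhibit one. The restriction to t > 0 makes room for the square root. *)
Fixpoint smooth_pos (R : realType) (n : nat) (f : R -> R) : Prop :=
  if n is m.+1 then
    exists f' : R -> R, (forall t : R, 0 < t -> is_derive t 1 f (f' t)) /\ smooth_pos m f'
  else True.

Lemma analytic1_smooth_pos (R : realType) n (f : R -> R) :
  analytic1 f -> smooth_pos n f.
Proof.
elim: n f => [//|n IH] f af /=; have [D a'] := analytic1_derive af.
by exists (derive1 f); split; [move=> t _; exact: D | exact: IH].
Qed.

Section smooth_pos_theory.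
Context {R : realType}.
Implicit Types f g : R -> R.

Lemma smooth_posW n f : smooth_pos n.+1 f -> smooth_pos n f.
Proof.
elim: n f => [//|n IH] f [f' [D s]]; exists f'; split => //.
exact: IH.
Qed.

Lemma smooth_pos_cst n c : smooth_pos n (fun _ : R => c).
Proof.
by elim: n c => [//|n IH] c /=; exists (fun=> 0); split => // t _; exact: is_derive_cst.
Qed.

Lemma smooth_posD n f g : smooth_pos n f -> smooth_pos n g ->
  smooth_pos n (fun t => f t + g t).
Proof.
elim: n f g => [//|n IH] f g [f' [Df sf]] [g' [Dg sg]].
exists (fun t => f' t + g' t); split; last exact: IH.
by move=> t t0; have := Df _ t0; have := Dg _ t0 => ? ?; exact: is_deriveD.
Qed.

Lemma smooth_posM n f g : smooth_pos n f -> smooth_pos n g ->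
  smooth_pos n (fun t => f t * g t).
Proof.
elim: n f g => [//|n IH] f g sf sg.
have sf1 := smooth_posW sf; have sg1 := smooth_posW sg.
move: sf sg => [f' [Df sf]] [g' [Dg sg]].
exists (fun t => f t * g' t + g t * f' t); split.
  by move=> t t0; have := Df _ t0; have := Dg _ t0 => ? ?; exact: is_deriveM.
by apply: smooth_posD; apply: IH.
Qed.

Lemma smooth_pos_comp n f g : (forall t : R, 0 < t -> 0 < g t) ->
  smooth_pos n f -> smooth_pos n g -> smooth_pos n (f \o g).
Proof.
move=> gp; elim: n f => [//|n IH] f [f' [Df sf]] sg.
have sg1 := smooth_posW sg; case: sg => [g' [Dg sg]].
exists (fun t => (f' \o g) t * g' t); split.
  move=> t t0; have := Df _ (gp _ t0); have := Dg _ t0 => ? ?.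
  exact: is_derive1_comp.
by apply: smooth_posM => //; exact: IH.
Qed.

Lemma smooth_pos_inv n : smooth_pos n (@GRing.inv R).
Proof.
elim: n => [//|n IH] /=.
exists (fun t => (-1) * (t^-1 * t^-1)); split.
  move=> t t0.
  have := @is_deriveV R id t 1 1 _ _ => /(_ (lt0r_neq0 t0) (is_derive_id _ _)).
  move=> ?; apply: is_derive_eq.
  by rewrite /= -exprVn expr2 /GRing.scale/= mulr1 mulN1r.
by do !apply: smooth_posM => //; exact: smooth_pos_cst.
Qed.

(** The derivative is half the inverse of the square root itself, so the induction on the order
    closes through [smooth_pos_comp]. *)
Lemma smooth_pos_sqrt n : smooth_pos n (@Num.sqrt R).
Proof.
elim: n => [//|n IH] /=.
exists (fun t => 2^-1 * (GRing.inv \o Num.sqrt) t); split.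
  move=> t t0; have := is_derive1_sqrt t0 => ?; apply: is_derive_eq.
  by rewrite /= invfM.
apply: smooth_posM; first exact: smooth_pos_cst.
by apply: smooth_pos_comp => //; [move=> t; rewrite sqrtr_gt0 | exact: smooth_pos_inv].
Qed.

Lemma smooth_pos_eq n f g : (forall t : R, 0 < t -> f t = g t) ->
  smooth_pos n f -> smooth_pos n g.
Proof.
case: n => [//|n] fg [f' [D s]]; exists f'; split => // t t0.
apply: near_eq_is_derive (D _ t0).
by near=> u; apply: fg; near: u; exact: lt_nbhsr.
Unshelve. all: by end_near. Qed.

Lemma smooth_pos_derive1 n f : smooth_pos n.+1 f ->
  (forall t : R, 0 < t -> is_derive t 1 f ((derive1 f) t)) /\ smooth_pos n (derive1 f).
Proof.
move=> [f' [D s]].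
have E t : 0 < t -> f' t = (derive1 f) t.
  by move=> t0; rewrite derive1E; have := D _ t0 => ?; rewrite derive_val.
split; last exact: smooth_pos_eq s.
by move=> t t0; rewrite -E//; exact: D.
Qed.

(** Trades the existential witnesses for the canonical iterated derivatives. *)
Lemma smooth_pos_derive1n f : (forall n, smooth_pos n f) ->
  forall n (t : R), 0 < t -> is_derive t 1 (derive1n n f) (derive1n n.+1 f t).
Proof.
move=> sf n t t0.
suff s m : smooth_pos m (derive1n n f).
  by have [D _] := smooth_pos_derive1 (s 1%N); rewrite derive1nS; exact: D.
elim: n m => [//|n IH] m.
by rewrite derive1nS; have [_ ] := smooth_pos_derive1 (IH m.+1).
Qed.

End smooth_pos_theory.

(** * Rotation invariant functions as functions of the squared radius *)

Section rotation_invariant_profile.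
Context {R : realType} (Psi : R -> R -> R).
Hypotheses (hana : real_analytic2 Psi) (hrot : rotation_invariant Psi).

(** On the axis only the column j = 0 of the double series survives, because 0 ^ j = 0 for j > 0. *)
Lemma real_analytic2_axis : analytic1 (Psi^~ 0).
Proof.
move=> a; have [c [r [r0 H]]] := hana a 0.
exists (c^~ 0%N), r; split; [exact: r0 | move=> t tr].
have := H t 0 tr; rewrite subrr normr0 => /(_ r0)[_].
apply: cvg_trans; apply: near_eq_cvg; exists 1%N => // -[//|N] _.
rewrite /pseries /series /= big_mkord; apply: eq_bigr => i _.
rewrite big_ord_recl /= expr0 mulr1 big1 ?addr0// => j _.
by rewrite expr0n /= mulr0.
Qed.

(** Rotating by the polar angle of (x, y) carries the point to (r, 0); the origin, which has no
    polar angle, is treated separately. *)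
Lemma rotation_invariant_radius x y : Psi x y = Psi (Num.sqrt (x ^+ 2 + y ^+ 2)) 0.
Proof.
set r := Num.sqrt _.
have r2 : r ^+ 2 = x ^+ 2 + y ^+ 2 by rewrite sqr_sqrtr// addr_ge0 ?sqr_ge0.
have [r0|r0] := eqVneq r 0.
  have : x ^+ 2 + y ^+ 2 = 0 by rewrite -r2 r0 expr0n.
  move/eqP; rewrite paddr_eq0 ?sqr_ge0// !sqrf_eq0 => /andP[/eqP-> /eqP->].
  by rewrite r0.
have rp : 0 < r by rewrite lt_neqAle eq_sym r0 sqrtr_ge0.
have xr : -1 <= x / r <= 1.
  rewrite -ler_norml normrM normfV (gtr0_norm rp) ler_pdivrMr// mul1r.
  by rewrite -(@ler_pXn2r _ 2)// ?nnegrE ?(ltW rp)// real_normK ?num_real// r2 lerDl sqr_ge0.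
have [phi [cphi sphi]] : exists phi : R, cos phi = x / r /\ sin phi = y / r.
  have c0 : cos (acos (x / r)) = x / r by rewrite acosK.
  have s0 : sin (acos (x / r)) = `|y / r|.
    rewrite sin_acos// -sqrtr_sqr; congr Num.sqrt.
    rewrite !expr_div_n; apply: (@mulIf _ (r ^+ 2)); first by rewrite sqrf_eq0.
    by rewrite mulrBl !divfK ?sqrf_eq0// mul1r r2 addrAC subrr add0r.
  (* [acos] only yields angles in [0, pi], so the sign of [y] decides between the angle and its
     opposite. *)
  have [y0|y0] := leP 0 (y / r).
    by exists (acos (x / r)); rewrite c0 s0 ger0_norm.
  by exists (- acos (x / r)); rewrite cosN sinN c0 s0 ltr0_norm// opprK.
rewrite -(hrot.1 phi x y) /rot_x /rot_y cphi sphi; congr Psi.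
  apply: (mulfI r0); rewrite -[RHS]expr2 r2; field.
  exact: r0.
by field.
Qed.

Lemma rotation_invariant_swap x y : Psi x y = Psi y x.
Proof. by rewrite rotation_invariant_radius addrC -rotation_invariant_radius. Qed.

(* Only meaningful for s > 0. *)
Definition profile (j : nat) : R -> R := derive1n j (fun s => Psi (Num.sqrt s) 0).

Lemma is_derive_profile j (s : R) : 0 < s -> is_derive s 1 (profile j) (profile j.+1 s).
Proof.
apply: smooth_pos_derive1n => n.
apply: (@smooth_pos_comp _ _ (Psi^~ 0) Num.sqrt) => [t||].
- by rewrite sqrtr_gt0.
- exact/analytic1_smooth_pos/real_analytic2_axis.
- exact: smooth_pos_sqrt.
Qed.

Lemma profileE x y : Psi x y = profile 0 (x ^+ 2 + y ^+ 2).
Proof. exact: rotation_invariant_radius. Qed.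

End rotation_invariant_profile.

(** * Substitution in the Riemann-Liouville integral *)

Lemma is_derive1_cvg (R : realType) (f : R -> R) (x d : R) :
  is_derive x 1 f d -> f t @[t --> x] --> f x.
Proof. by move=> Df; apply/differentiable_continuous/derivable1_diffP. Qed.

Section RL_substitution.
Context {R : realType} (beta : R).
Hypotheses (beta_gt0 : 0 < beta) (beta_lt1 : beta < 1).
Notation mu := (@lebesgue_measure R).
Let gamma : R := (1 - beta)^-1.

(* With u = x * RLsub v one has x - u = x * v `^ gamma, and the Jacobian cancels
   the singularity: - du / (x - u) `^ beta = gamma * x `^ (1 - beta) dv. *)
Definition RLsub (v : R) : R := 1 - v `^ gamma.

Let gamma_gt1 : 1 < gamma.
Proof. by rewrite /gamma invf_gt1 ?subr_gt0// gtrBl. Qed.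

Let gammaE : gamma - 1 = gamma * beta.
Proof. by rewrite /gamma; field; rewrite subr_eq0 gt_eqF. Qed.

Let gamma_gt0 : 0 < gamma. Proof. exact: lt_trans ltr01 gamma_gt1. Qed.

Lemma RLsub1 : RLsub 1 = 0. Proof. by rewrite /RLsub powR1 subrr. Qed.

Lemma RLsub0 : RLsub 0 = 1.
Proof. by rewrite /RLsub powR0 ?subr0// gt_eqF. Qed.

Lemma RLsub_decreasing (u v : R) : 0 <= u -> u < v -> RLsub v < RLsub u.
Proof.
have g0 := gamma_gt0; move=> u0 uv; rewrite /RLsub ltrD2l ltrN2 gt0_ltr_powR// nnegrE; lra.
Qed.

Lemma RLsub_itv (v : R) : 0 <= v <= 1 -> 0 <= RLsub v <= 1.
Proof.
have g0 := gamma_gt0; move=> /andP[v0 v1]; rewrite /RLsub subr_ge0 gerBl powR_ge0 andbT.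
have p1 : 1 `^ gamma = 1 by rewrite powR1.
by rewrite -[leRHS]p1 ge0_ler_powR ?nnegrE//; lra.
Qed.

Lemma is_derive_RLsub (v : R) : 0 < v -> is_derive v 1 RLsub (- (gamma * v `^ (gamma - 1))).
Proof.
move=> v0; have := is_derive1_powR gamma v0 => ?.
by rewrite /RLsub; apply: is_derive_eq; rewrite add0r mul1r.
Qed.

Lemma continuous_RLsub : {within `[0, 1], continuous RLsub}.
Proof.
have cv (v : R) : 0 < v -> {for v, continuous RLsub}.
  by move=> v0; exact: is_derive1_cvg (is_derive_RLsub v0).
apply/continuous_within_itvP => //; split.
- by move=> v; rewrite in_itv/= => /andP[v0 _]; exact: cv.
- rewrite RLsub0 -[X in _ --> X](subr0 1); apply: cvgB; first exact: cvg_cst.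
  by apply: powR_cvg0.
- by apply: cvg_at_left_filter; apply: cv.
Qed.

(** Cutting off v < e removes the singular endpoint u = x, so the change of variables for continuous
    integrands applies. *)
Lemma RL_substitution_trunc (f : R -> R) (x e : R) : continuous f -> 0 < x ->
  0 < e < 1 ->
  (\int[mu]_(u in `[0%R, (x * RLsub e)%R]) (f u / (x - u) `^ beta)%R%:E =
   \int[mu]_(v in `[e, 1%R]) (gamma * x `^ (1 - beta) * f (x * RLsub v))%R%:E)%E.
Proof.
move=> cf x0 /andP[e0 e1].
pose F v := x * RLsub v.
have F1 : F 1 = 0 by rewrite /F RLsub1 mulr0.
pose dF (v : R) := - (x * (gamma * v `^ (gamma - 1))).
have DF (v : R) : 0 < v -> is_derive v 1 F (dF v).
  move=> v0; have := is_derive_RLsub v0 => ?.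
  by apply: is_derive_eq; rewrite /dF scalerN.
have FE (v : R) : 0 < v -> (derive1 F) v = dF v.
  by move=> v0; have := DF _ v0 => ?; rewrite derive1E derive_val.
have cF (v : R) : 0 < v -> {for v, continuous F}.
  by move=> v0; exact: is_derive1_cvg (DF v v0).
have cdF (v : R) : 0 < v -> {for v, continuous (derive1 F)}.
  move=> v0; rewrite /prop_for /continuous_at (FE _ v0).
  apply: (@cvg_trans _ (dF @ v)).
    apply: near_eq_cvg; near=> w; rewrite FE//.
    by near: w; exact: lt_nbhsr.
  have := is_derive1_cvg (is_derive1_powR (gamma - 1) v0) => cpw.
  have : x * (gamma * u `^ (gamma - 1)) @[u --> v] --> x * (gamma * v `^ (gamma - 1)).
    by do 2 apply: cvgMl_tmp; exact: cpw.
  by move/cvgN.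
rewrite -F1 -/(F e) (@integration_by_substitution_decreasing _ F _ e 1).
- apply: eq_integral => v; rewrite inE/= in_itv/= => /andP[ev v1].
  have v0 : 0 < v by lra.
  congr EFin; rewrite !fctE FE// /dF opprK /=.
  have -> : x - F v = x * v `^ gamma by rewrite /F /RLsub; ring.
  rewrite powRM ?powR_ge0 ?(ltW x0)// -powRrM gammaE.
  rewrite powRB ?(gt_eqF x0) ?implybT// powRr1 ?(ltW x0)//.
  field; rewrite !gt_eqF ?powR_gt0//.
- exact: ltW.
- move=> u v; rewrite !in_itv/= => /andP[u0 _] /andP[v0 _] vu.
  by rewrite /F ltr_pM2l// RLsub_decreasing//; lra.
- by move=> v; rewrite in_itv/= => /andP[v0 _]; apply: cdF; lra.
- by apply/cvg_ex; exists (derive1 F e); apply: cvg_at_right_filter; apply: cdF.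
- by apply/cvg_ex; exists (derive1 F 1); apply: cvg_at_left_filter; apply: cdF.
- split.
  + move=> v; rewrite in_itv/= => /andP[v0 _].
    by have := DF v ltac:(lra) => ?; exact: ex_derive.
  + by apply: cvg_at_right_filter; exact: cF.
  + by apply: cvg_at_left_filter; exact: cF.
- have Fx u : u \in `[F 1, F e] -> 0 < x - u.
    rewrite in_itv/= => /andP[_ uF]; rewrite subr_gt0 (le_lt_trans uF)//.
    by rewrite /F gtr_pMr// /RLsub gtrBl powR_gt0.
  apply: continuous_in_subspaceT => u /[!inE] /Fx xu.
  apply: cvgM; first exact: cf.
  apply: cvgV; first by rewrite gt_eqF// powR_gt0.
  apply: (@continuous_comp _ _ _ (fun u => x - u) (@powR R ^~ beta)).
    by apply: cvgB; [exact: cvg_cst|exact: cvg_id].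
  exact: is_derive1_cvg (is_derive1_powR beta xu).
Unshelve. all: by end_near. Qed.


Lemma continuous_comp_RLsub (g : R -> R) : continuous g ->
  {within `[0, 1], continuous (g \o RLsub)}.
Proof.
move=> cg; apply/subspace_continuousP => v v01.
have /subspace_continuousP/(_ v v01) cs := continuous_RLsub.
exact: (cvg_comp _ _ cs (cg _)).
Qed.

Lemma integrable_comp_RLsub (g : R -> R) : continuous g ->
  mu.-integrable `[0, 1] (EFin \o (g \o RLsub)).
Proof.
move=> cg; apply: continuous_compact_integrable; first exact: segment_compact.
exact: continuous_comp_RLsub.
Qed.

Let continuous_scale (c x : R) (f : R -> R) : continuous f ->
  continuous (fun s => c * f (x * s)).
Proof.
move=> cf s; apply: cvgMl_tmp; apply: (@continuous_comp _ _ _ (fun s => x * s) f).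
  by apply: cvgMl_tmp; exact: cvg_id.
exact: cf.
Qed.

Let measurable_RL_integrand (f : R -> R) (x : R) : continuous f ->
  measurable_fun setT (fun u => f u / (x - u) `^ beta).
Proof.
move=> cf; apply: measurable_funM; first exact: continuous_measurable_fun.
rewrite [X in measurable_fun _ X](_ : _ = (@powR R ^~ (- beta)) \o (fun u => x - u)); last first.
  by apply/funext => u /=; rewrite powRN.
apply: measurableT_comp => //.
by apply: measurable_funB.
Qed.

(** Monotone convergence as e tends to 0 in [RL_substitution_trunc]: for nonnegative integrands both
    sides increase to the full integrals. *)
Lemma RL_substitution_ge0 (f : R -> R) (x : R) : continuous f -> 0 < x ->
  (forall u : R, 0 <= u <= x -> 0 <= f u) ->
  (\int[mu]_(u in `[0%R, x[) (f u / (x - u) `^ beta)%:E =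
   \int[mu]_(v in `[0%R, 1%R]) (gamma * x `^ (1 - beta) * f (x * RLsub v))%:E)%E.
Proof.
move=> cf x0 f0.
pose e n : R := n.+2%:R^-1.
have e_gt0 n : 0 < e n by rewrite invr_gt0.
have e_lt1 n : e n < 1 by rewrite invf_lt1// ltr1n.
have e_noninc m n : (m <= n)%N -> e n <= e m.
  by move=> mn; rewrite lef_pV2 ?posrE// ler_nat.
have e_small (r : R) : 0 < r -> exists n, e n <= r.
  move=> r0; have [n _ /(_ n (leqnn n)) nr] := near_infty_natSinv_lt (PosNum r0).
  exists n; apply: ltW; apply: le_lt_trans nr.
  by rewrite lef_pV2 ?posrE// ler_nat.
pose A n : set R := `[0, x * RLsub (e n)]%classic.
pose B n : set R := `[e n, 1]%classic.
have UA : \bigcup_n A n = `[0, x[%classic.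
  apply/seteqP; split=> [u [n _]|u].
    rewrite /A /= !in_itv/= => /andP[-> /le_lt_trans]; apply.
    by rewrite gtr_pMr// /RLsub gtrBl powR_gt0.
  rewrite /= in_itv/= => /andP[u0 ux].
  have ux1 : 0 < 1 - u / x by rewrite subr_gt0 ltr_pdivrMr// mul1r.
  (* A point u < x lies in [A n] as soon as (e n)^gamma <= 1 - u / x. *)
  have [n en] := e_small ((1 - u / x) `^ gamma^-1) (powR_gt0 _ ux1).
  exists n => //; rewrite /A /= in_itv/= u0/= mulrC -ler_pdivrMr//.
  rewrite /RLsub lerBrDl -lerBrDr.
  apply: le_trans (ge0_ler_powR (ltW gamma_gt0) _ _ en) _;
    rewrite ?nnegrE ?powR_ge0 ?(ltW (e_gt0 _))//.
  by rewrite -powRrM mulVf ?gt_eqF// powRr1 ?(ltW ux1).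
have UB : \bigcup_n B n = `]0, 1]%classic.
  apply/seteqP; split=> [u [n _]|u].
    by rewrite /B /= !in_itv/= => /andP[/(lt_le_trans (e_gt0 n)) -> ->].
  rewrite /= in_itv/= => /andP[u0 u1].
  by have [n en] := e_small u u0; exists n => //; rewrite /B/= in_itv/= en u1.
have ndA : nondecreasing_seq A.
  move=> m n mn; apply/subsetPset => u; rewrite /A/= !in_itv/= => /andP[-> /le_trans]; apply.
  rewrite ler_pM2l// /RLsub lerD2l lerN2.
  have le0e i : e i \in Num.nneg by rewrite nnegrE ltW.
  by apply: ge0_ler_powR; rewrite ?le0e ?e_noninc// ltW.
have ndB : nondecreasing_seq B.
  move=> m n mn; apply/subsetPset => u; rewrite /B/= !in_itv/= => /andP[eu ->].
  by rewrite (le_trans _ eu)// e_noninc.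
have mk (D : set R) : measurable D -> measurable_fun D (fun u => f u / (x - u) `^ beta).
  move=> mD; apply: (@measurable_funS _ _ _ _ setT) => //.
  exact: measurable_RL_integrand.
have m01 : measurable_fun (`[0, 1]%classic : set R)
    (fun v => gamma * x `^ (1 - beta) * f (x * RLsub v)).
  have c01 := continuous_comp_RLsub (@continuous_scale (gamma * x `^ (1 - beta)) x f cf).
  exact: subspace_continuous_measurable_fun c01.
have B01 n : B n `<=` `[0, 1]%classic.
  move=> v; rewrite /B/= !in_itv/= => /andP[ev ->]; rewrite andbT.
  exact: le_trans (ltW (e_gt0 n)) ev.
rewrite -[RHS]integral_itv_obnd_cbnd; last first.
  apply/measurable_EFinP; apply: measurable_funS m01 => //; exact: subset_itv_oc_cc.
rewrite -UA -UB.
have cA : (\int[mu]_(u in A n) (f u / (x - u) `^ beta)%:E @[n --> \oo] -->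
    \int[mu]_(u in \bigcup_n A n) (f u / (x - u) `^ beta)%:E)%E.
  apply: ge0_nondecreasing_set_cvg_integral => //.
    by move=> i; exact: measurable_itv.
    by move=> i; apply/measurable_EFinP; apply: mk; exact: measurable_itv.
  move=> n u Anu; have : (`[0, x[)%classic u by rewrite -UA; exists n.
  rewrite /= in_itv/= => /andP[u0 ux].
  by rewrite lee_fin divr_ge0 ?powR_ge0// f0// u0 ltW.
have cB : (\int[mu]_(v in B n) (gamma * x `^ (1 - beta) * f (x * RLsub v))%:E @[n --> \oo] -->
    \int[mu]_(v in \bigcup_n B n) (gamma * x `^ (1 - beta) * f (x * RLsub v))%:E)%E.
  apply: ge0_nondecreasing_set_cvg_integral => //.
  - by move=> i; exact: measurable_itv.
  - by move=> n; apply/measurable_EFinP; exact: measurable_funS m01.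
  - move=> n v /B01; rewrite /= in_itv/= => /RLsub_itv/andP[s0 s1].
    rewrite lee_fin !mulr_ge0 ?powR_ge0 ?(ltW gamma_gt0)// f0// mulr_ge0 ?(ltW x0)//=.
    by rewrite ler_piMr// ltW.
move: cA cB.
rewrite [X in X @ _ --> _](_ : _ = (fun n =>
  \int[mu]_(v in B n) (gamma * x `^ (1 - beta) * f (x * RLsub v))%:E)%E); last first.
  by apply/funext => n; rewrite RL_substitution_trunc// e_gt0 e_lt1.
exact: cvg_unique.
Qed.

(** A continuous [f] is bounded below on [0, x], so f = (f + C) - C reduces to two nonnegative
    integrands. *)
Lemma RL_integralE (f : R -> R) (x : R) : continuous f -> 0 < x ->
  RL_integral beta f x =
  gamma * x `^ (1 - beta) * \int[mu]_(v in `[0, 1]) f (x * RLsub v).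
Proof.
move=> cf x0.
have [C C0 fC] : exists2 C : R, 0 <= C & forall u, 0 <= u <= x -> 0 <= f u + C.
  have cw : {within `[0, x], continuous f} by exact: continuous_subspaceT.
  have [c _ fc] := EVT_min (ltW x0) cw.
  exists `|f c| => // u ux; rewrite -lerBlDr sub0r (le_trans _ (fc u _))//.
  by rewrite lerNl -normrN ler_norm.
have intE (g : R -> R) : continuous g -> (forall u, 0 <= u <= x -> 0 <= g u) ->
    mu.-integrable `[0, x[ (fun u => (g u / (x - u) `^ beta)%:E) /\
    \int[mu]_(u in `[0, x[) (g u / (x - u) `^ beta) =
    gamma * x `^ (1 - beta) * \int[mu]_(v in `[0, 1]) g (x * RLsub v).
  move=> cg g0; have E := RL_substitution_ge0 cg x0 g0.
  have I := integrable_comp_RLsub (@continuous_scale 1 x g cg).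
  have I' := integrable_comp_RLsub (@continuous_scale (gamma * x `^ (1 - beta)) x g cg).
  split; last first.
    rewrite /Rintegral E -/(Rintegral _ _ _) -RintegralZl//.
    by apply: eq_integrable I => // v _ /=; rewrite mul1r.
  apply/integrableP; split.
    apply/measurable_EFinP; apply: (@measurable_funS _ _ _ _ setT) => //.
    exact: measurable_RL_integrand.
  (* The integrand is nonnegative, so its L1 norm is its integral, which [E] equates with that of a
     function continuous on [0, 1], hence finite. *)
  suff -> : (\int[mu]_(u in `[0%R, x[) `|(g u / (x - u) `^ beta)%:E| =
      \int[mu]_(u in `[0%R, x[) (g u / (x - u) `^ beta)%:E)%E.
    rewrite E ltey_eq; apply/orP; left; exact: integrable_fin_num I'.
  apply: eq_integral => u; rewrite inE/= in_itv/= => /andP[u0 ux].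
  by rewrite ger0_norm// divr_ge0 ?powR_ge0// g0// u0 ltW.
have cC : continuous (cst C : R -> R) by move=> u; exact: cvg_cst.
have cfC : continuous (fun u => f u + C).
  by move=> u; apply: cvgD; [exact: cf | exact: cvg_cst].
have [i1 e1] := intE (fun u => f u + C) cfC fC.
have [i2 e2] := intE (cst C) cC (fun _ _ => C0).
have fE u : f u / (x - u) `^ beta = (f u + C) / (x - u) `^ beta - C / (x - u) `^ beta.
  by rewrite -mulrBl addrK.
have i3 : mu.-integrable `[0, x[ (EFin \o (fun u => f u / (x - u) `^ beta)).
  rewrite (_ : _ \o _ = (fun u => ((f u + C) / (x - u) `^ beta)%:E - (C / (x - u) `^ beta)%:E)%E).
    exact: integrableB.
  by apply/funext => u /=; rewrite fE.
rewrite /RL_integral -Rintegral_itv_bndo_bndc//.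
under eq_Rintegral do rewrite fE.
rewrite RintegralB// e1 e2 -mulrBr -RintegralB//.
- by congr *%R; apply: eq_Rintegral => v _; rewrite addrK.
- have I := integrable_comp_RLsub (@continuous_scale 1 x _ cfC).
  by apply: eq_integrable I => // v _ /=; rewrite mul1r.
- have I := integrable_comp_RLsub (@continuous_scale 1 x _ cC).
  by apply: eq_integrable I => // v _ /=; rewrite mul1r.
Qed.

(** The primitive [H v = v * f (x * RLsub v)] is 0 at v = 0 and f 0 at v = 1. Its factor v makes H'
    a function of [RLsub v] alone, since v * v^(gamma - 1) = 1 - RLsub v. *)
Lemma RLsub_integration_by_parts (f f' : R -> R) (x : R) :
  (forall u : R, is_derive u 1 f (f' u)) -> continuous f' ->
  \int[mu]_(v in `[0, 1]) f (x * RLsub v) =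
  f 0 + gamma * x * \int[mu]_(v in `[0, 1]) ((1 - RLsub v) * f' (x * RLsub v)).
Proof.
move=> Df cf'.
have cf : continuous f by move=> u; exact: is_derive1_cvg (Df u).
have cxf (g : R -> R) : continuous g -> continuous (fun s => g (x * s)).
  move=> cg s; have := @continuous_scale 1 x g cg s.
  by rewrite /continuous_at mul1r; under eq_fun do rewrite mul1r.
pose k s := (1 - s) * f' (x * s).
have ck : continuous k.
  move=> s; apply: cvgM; last exact: cxf.
  by apply: cvgB; [exact: cvg_cst | exact: cvg_id].
have i1 := integrable_comp_RLsub (cxf _ cf).
have i2 := integrable_comp_RLsub ck.
pose H v := v * f (x * RLsub v).
pose h s := f (x * s) - gamma * x * k s.
have ch : continuous h.
  move=> s; apply: cvgB; first exact: cxf.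
  by apply: cvgMl_tmp; exact: ck.
have cH : {within `[0, 1], continuous H}.
  apply/subspace_continuousP => v v01; apply: cvgM.
    exact: cvg_within.
  by have /subspace_continuousP := continuous_comp_RLsub (cxf _ cf); apply.
have DH (v : R) : 0 < v -> is_derive v 1 H (h (RLsub v)).
  move=> v0; have D1 := is_derive_RLsub v0; have D2 := Df (x * RLsub v).
  have D3 : is_derive v 1 (fun v => f (x * RLsub v))
      (f' (x * RLsub v) * (x * - (gamma * v `^ (gamma - 1)))).
    exact: (@is_derive1_comp _ f (fun v => x * RLsub v)).
  have := is_deriveM (is_derive_id v (1 : R)) D3 => D4.
  apply: is_derive_eq.
  have E : 1 - RLsub v = v * v `^ (gamma - 1).
    by rewrite /RLsub opprB addrCA subrr addr0 mulr_powRB1// ltW.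
  rewrite /h /k E /GRing.scale/=; ring.
have /(congr1 fine) : (\int[mu]_(v in `[0%R, 1%R]) ((h \o RLsub) v)%:E = (H 1)%:E - (H 0)%:E)%E.
  apply: continuous_FTC2 => //.
  - exact: continuous_comp_RLsub.
  - have /(continuous_within_itvP _ ltr01)[_ H0 H1] := cH.
    split; [move=> v | exact: H0 | exact: H1]; rewrite in_itv/= => /andP[v0 _].
    by have := DH _ v0 => ?; exact: ex_derive.
  - move=> v; rewrite in_itv/= => /andP[v0 _].
    by have := DH _ v0 => ?; rewrite derive1E derive_val.
rewrite -/(Rintegral _ _ _) /= /H RLsub1 mulr0 mul0r mul1r subr0 => <-.
rewrite /h RintegralB//; last first.
  have cgk : continuous (fun s => gamma * x * k s) by move=> s; apply: cvgMl_tmp; exact: ck.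
  exact: (integrable_comp_RLsub cgk).
by rewrite RintegralZl// subrK.
Qed.

End RL_substitution.

(** * Derivatives of the Riemann-Liouville integral of a radial function *)

Section radial_jets.
Context {R : realType} (h : nat -> R -> R).
Hypothesis Dh : forall j (s : R), 0 < s -> is_derive s 1 (h j) (h j.+1 s).

(* [jet i j u z] is the i-th derivative in u of [h j (u ^+ 2 + z)]; the
   recursion is Leibniz' rule for the (i - 1)-st derivative of
   [2 * u * h j.+1 (u ^+ 2 + z)]. *)
Fixpoint jet (i j : nat) (u z : R) {struct i} : R :=
  if i is i1.+1 then
    2 * u * jet i1 j.+1 u z +
    (if i1 is i2.+1 then 2 * i1%:R * jet i2 j.+1 u z else 0)
  else h j (u ^+ 2 + z).

Lemma jetS i j u z :
  jet i.+1 j u z = 2 * u * jet i j.+1 u z + 2 * i%:R * jet i.-1 j.+1 u z.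
Proof. by case: i => [|i] //=; rewrite mulr0 mul0r. Qed.

(** Raising i is D_u and raising j is D_z, so this is the chain rule along a curve. The induction is
    strong because the recursion reaches two levels down. *)
Lemma is_derive_jet i j (u z : R -> R) (t du dz : R) : 0 < z t ->
  is_derive t 1 u du -> is_derive t 1 z dz ->
  is_derive t 1 (fun w => jet i j (u w) (z w))
    (jet i.+1 j (u t) (z t) * du + jet i j.+1 (u t) (z t) * dz).
Proof.
move=> zt Du Dz; elim/ltn_ind: i j => -[_ j|i IH j].
  have D1 : is_derive t 1 (fun w => u w ^+ 2 + z w) (2 * u t * du + dz).
    apply: is_derive_eq; rewrite /GRing.scale/=; ring.
  have := Dh j (ltr_wpDl (sqr_ge0 (u t)) zt) => D2.
  rewrite (_ : _ + _ = h j.+1 (u t ^+ 2 + z t) * (2 * u t * du + dz)); last by rewrite /=; ring.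
  exact: (@is_derive1_comp R (h j) (fun w => u w ^+ 2 + z w) t _ _ D2 D1).
have D1 := IH i (ltnSn i) j.+1.
case: i IH D1 => [|i] IH D1.
  rewrite (_ : (fun w => _) = (fun w => 2 * (u w * jet 0 j.+1 (u w) (z w)))); last first.
    by apply/funext => w; rewrite /= mulrA addr0.
  by apply: is_derive_eq; rewrite /GRing.scale/=; ring.
have D2 := IH i (ltnW (ltnSn _)) j.+1.
rewrite (_ : (fun w => _) = (fun w => 2 * (u w * jet i.+1 j.+1 (u w) (z w)) +
    (2 * i.+1%:R) * jet i j.+1 (u w) (z w))); last first.
  by apply/funext => w; rewrite jetS /= mulrA.
apply: is_derive_eq.
have -> : jet i.+3 j (u t) (z t) =
    2 * u t * jet i.+2 j.+1 (u t) (z t) + 2 * (i.+1%:R + 1) * jet i.+1 j.+1 (u t) (z t).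
  by rewrite jetS natr1.
rewrite (jetS i.+1 j.+1) /GRing.scale/= -/(jet i.+1 j.+1 (u t) (z t)); ring.
Qed.

(** A general filter serves both continuity in one variable and joint continuity on a product. *)
Lemma cvg_jet i j (T : Type) (F : set_system T) (FF : Filter F) (u z : T -> R) (u0 z0 : R) :
  0 < z0 -> u @ F --> u0 -> z @ F --> z0 ->
  jet i j (u t) (z t) @[t --> F] --> jet i j u0 z0.
Proof.
move=> z00 cu cz; elim/ltn_ind: i j => -[_ j|i IH j].
  have D := Dh j (ltr_wpDl (sqr_ge0 u0) z00).
  apply: (cvg_comp _ _ _ (is_derive1_cvg D)).
  by apply: cvgD => //; apply: cvgM.
have c1 := IH i (ltnSn i) j.+1.
case: i IH c1 => [|i] IH c1.
  rewrite /= addr0; under eq_fun do rewrite addr0.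
  by apply: cvgM => //; apply: cvgMl_tmp.
apply: cvgD; first by apply: cvgM => //; apply: cvgMl_tmp.
by apply: cvgMl_tmp; exact: IH.
Qed.

End radial_jets.

(** * Differentiation under the integral sign *)

Section RL_jets.
Context {R : realType} (h : nat -> R -> R).
Hypothesis Dh : forall j (s : R), 0 < s -> is_derive s 1 (h j) (h j.+1 s).
Variable beta : R.
Hypotheses (beta_gt0 : 0 < beta) (beta_lt1 : beta < 1).
Notation mu := (@lebesgue_measure R).
Notation sub := (RLsub beta).
Notation jet := (jet h).

Lemma is_derive_RLsub_integral (k dk : R -> R -> R) (a u v C : R) : u < a < v ->
  (forall t : R, u < t < v -> continuous (k t)) ->
  (forall t s : R, u < t < v -> 0 <= s <= 1 -> is_derive t 1 (k^~ s) (dk t s)) ->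
  (forall t s : R, u < t < v -> 0 <= s <= 1 -> `|dk t s| <= C) ->
  is_derive a 1 (fun t => \int[mu]_(w in `[0, 1]) k t (sub w))
    (\int[mu]_(w in `[0, 1]) dk a (sub w)).
Proof.
move=> uav ck Dk bk.
have subP w : (`[0, 1]%classic : set R) w -> 0 <= sub w <= 1.
  by rewrite /= in_itv/= => /(RLsub_itv beta_gt0 beta_lt1).
have C0 : 0 <= C.
  by apply: le_trans (bk a 0 uav _); rewrite ?normr_ge0 ?lexx ?ler01.
pose f t w := k t (sub w).
have Df t w : u < t < v -> (`[0, 1]%classic : set R) w ->
    is_derive t 1 (f^~ w) (dk t (sub w)).
  by move=> tu /subP; exact: Dk.
have pE t w : u < t < v -> (`[0, 1]%classic : set R) w -> partial1of2 f t w = dk t (sub w).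
  by move=> tu w01; have := Df _ _ tu w01 => ?; rewrite partial1of2E derive_val.
have intf t : (`]u, v[%classic : set R) t -> mu.-integrable `[0, 1] (EFin \o f t).
  rewrite /= in_itv/= => tu; exact: integrable_comp_RLsub (ck _ tu).
have derf t w : (`]u, v[%classic : set R) t -> (`[0, 1]%classic : set R) w -> derivable (f^~ w) t 1.
  by rewrite /= in_itv/= => tu w01; have := Df _ _ tu w01 => ?; exact: ex_derive.
have intC : mu.-integrable `[0, 1] (EFin \o cst C).
  by apply: continuous_compact_integrable; [exact: segment_compact | exact: cst_continuous].
have bf t w : (`]u, v[%classic : set R) t -> (`[0, 1]%classic : set R) w ->
    `|partial1of2 f t w| <= cst C w.
  by rewrite /= in_itv/= => tu w01; rewrite pE// bk// subP.
have Ia : (`]u, v[%classic : set R) a by rewrite /= in_itv.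
have D := @derivable_under_integral R _ _ mu f _ (measurable_itv `[0, 1])
  a u v Ia intf derf (cst C) (fun=> C0) intC bf.
have E := @differentiation_under_integral R _ _ mu f _ (measurable_itv `[0, 1])
  a u v Ia intf derf (cst C) (fun=> C0) intC bf.
apply: DeriveDef; first exact: D.
rewrite -derive1E E; apply: eq_Rintegral => w; rewrite inE => w01.
by rewrite pE.
Qed.

Let curve_gt0 (c e a : R) : 0 < c + e * a ^+ 2 ->
  exists2 r : R, 0 < r & forall t : R, a - r <= t <= a + r -> 0 < c + e * t ^+ 2.
Proof.
move=> z0.
have D : is_derive a 1 (fun t : R => c + e * t ^+ 2) (e * (2 * a)).
  by apply: is_derive_eq; rewrite /GRing.scale/=; ring.
have /cvgrPdist_lt/(_ _ z0) /nbhs_ballP[r /= r0 rb] := is_derive1_cvg D.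
exists (r / 2); first by rewrite divr_gt0.
move=> t tr; have bt : ball a r t by rewrite /ball/= ltr_distlC; lra.
by have := rb _ bt; rewrite /= ltr_distl => /andP[_]; rewrite ltrDr.
Qed.

Lemma continuous_jet_scale i j (c z : R) : 0 < z -> continuous (fun s => jet i j (c * s) z).
Proof.
move=> z0 s; apply: (cvg_jet Dh) => //; last exact: cvg_cst.
by apply: cvgMl_tmp; exact: cvg_id.
Qed.

Definition jetJ i j (x z : R) : R := \int[mu]_(w in `[0, 1]) jet i j (x * sub w) z.

(** The curve z = c + e t^2 serves twice: e = 0 freezes z and gives the partial derivative in x,
    while e = -1 keeps t^2 + z constant, as on a rotation orbit. *)
Lemma is_derive_jetJ i j (c e a : R) : 0 < c + e * a ^+ 2 ->
  is_derive a 1 (fun t => jetJ i j t (c + e * t ^+ 2))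
    (\int[mu]_(w in `[0, 1]) (sub w * jet i.+1 j (a * sub w) (c + e * a ^+ 2))
     + 2 * e * a * jetJ i j.+1 a (c + e * a ^+ 2)).
Proof.
move=> z0; have [r r0 zr] := curve_gt0 z0.
pose dk t s := s * jet i.+1 j (t * s) (c + e * t ^+ 2)
               + 2 * e * t * jet i j.+1 (t * s) (c + e * t ^+ 2).
(* The dominating constant comes from continuity of the t-derivative on this compact rectangle. *)
pose K := (`[a - r, a + r] `*` `[0, 1])%classic : set (R * R).
have cdk : {within K, continuous (fun p : R * R => dk p.1 p.2)}.
  apply: continuous_in_subspaceT => -[t s]; rewrite inE => -[/=].
  rewrite !in_itv/= => tr s01.
  have c1 : p.1 @[p --> (t, s)] --> t by exact: cvg_fst.
  have c2 : p.2 @[p --> (t, s)] --> s by exact: cvg_snd.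
  have cz : c + e * p.1 ^+ 2 @[p --> (t, s)] --> c + e * t ^+ 2.
    by apply: cvgD; [exact: cvg_cst|apply: cvgMl_tmp; apply: cvgM].
  have cu : p.1 * p.2 @[p --> (t, s)] --> t * s by exact: cvgM.
  have zt := zr _ tr.
  apply: cvgD; (apply: cvgM; last exact: (cvg_jet Dh)) => //.
  by apply: cvgMl_tmp.
have cK : compact K by apply: compact_setX; exact: segment_compact.
have /compact_bounded[M [_ Mb]] := continuous_compact cdk cK.
pose k t s := jet i j (t * s) (c + e * t ^+ 2).
have Ir : a - r < a < a + r by rewrite ltrBlDr ltrDl r0.
have ck (t : R) : a - r < t < a + r -> continuous (k t).
  move=> /andP[t1 t2]; apply: continuous_jet_scale; apply: zr.
  by rewrite !ltW.
have Dk (t s : R) : a - r < t < a + r -> 0 <= s <= 1 -> is_derive t 1 (k^~ s) (dk t s).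
  move=> /andP[t1 t2] _.
  have zt : 0 < c + e * t ^+ 2 by apply: zr; rewrite !ltW.
  have D1 : is_derive t 1 (fun t : R => t * s) s.
    by apply: is_derive_eq; rewrite /GRing.scale/=; ring.
  have D2 : is_derive t 1 (fun t : R => c + e * t ^+ 2) (2 * e * t).
    by apply: is_derive_eq; rewrite /GRing.scale/=; ring.
  have := @is_derive_jet _ _ Dh i j (fun t => t * s) (fun t => c + e * t ^+ 2) t _ _ zt D1 D2.
  by rewrite /dk mulrC [X in _ + X]mulrC.
have bk (t s : R) : a - r < t < a + r -> 0 <= s <= 1 -> `|dk t s| <= `|M| + 1.
  move=> /andP[t1 t2] s01; apply: (Mb (`|M| + 1)).
    by rewrite (le_lt_trans (ler_norm _))// ltrDl.
  by exists (t, s) => //; split; rewrite /= in_itv//= !ltW.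
apply: (is_derive_eq (is_derive_RLsub_integral Ir ck Dk bk)).
have i1 : mu.-integrable `[0, 1]
    (EFin \o ((fun s => s * jet i.+1 j (a * s) (c + e * a ^+ 2)) \o sub)).
  apply: integrable_comp_RLsub => // s; apply: cvgM; first exact: cvg_id.
  exact: continuous_jet_scale.
have i2 := integrable_comp_RLsub beta_gt0 beta_lt1 (@continuous_jet_scale i j.+1 a _ z0).
have i3 : mu.-integrable `[0, 1]
    (EFin \o ((fun s => 2 * e * a * jet i j.+1 (a * s) (c + e * a ^+ 2)) \o sub)).
  apply: integrable_comp_RLsub => // s; apply: cvgMl_tmp.
  exact: continuous_jet_scale.
by rewrite RintegralD// RintegralZl.
Qed.

Lemma is_derive_jet_x i j (z u : R) : 0 < z ->
  is_derive u 1 (fun u => jet i j u z) (jet i.+1 j u z).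
Proof.
move=> z0.
have D := @is_derive_jet _ _ Dh i j id (cst z) u 1 0 z0 (is_derive_id _ _) (is_derive_cst _ _ _).
by move: D; rewrite mulr1 mulr0 addr0.
Qed.

Lemma continuous_jet i j (z : R) : 0 < z -> continuous (fun u => jet i j u z).
Proof. by move=> z0 u; exact: is_derive1_cvg (is_derive_jet_x i j u z0). Qed.

(* The Riemann-Liouville integral, without the factor 1 / Gamma, of
   [fun u => jet i j u z]; see [RL_integralE]. *)
Definition jetI i j (x z : R) : R := (1 - beta)^-1 * x `^ (1 - beta) * jetJ i j x z.

Let onemJ i j (x z : R) :=
  \int[mu]_(w in `[0, 1]) ((1 - sub w) * jet i j (x * sub w) z).

Let jetJ_ibp i j (x z : R) : 0 < z ->
  jetJ i j x z = jet i j 0 z + (1 - beta)^-1 * x * onemJ i.+1 j x z.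
Proof.
move=> z0; exact: (@RLsub_integration_by_parts _ _ beta_gt0 beta_lt1 (fun u => jet i j u z)
  (fun u => jet i.+1 j u z) x (fun u => is_derive_jet_x i j u z0) (@continuous_jet i.+1 j z z0)).
Qed.

Let subJ i j (x z : R) : 0 < z ->
  \int[mu]_(w in `[0, 1]) (sub w * jet i j (x * sub w) z) = jetJ i j x z - onemJ i j x z.
Proof.
move=> z0; rewrite /jetJ /onemJ -RintegralB//.
- by apply: eq_Rintegral => w _; ring.
- exact: integrable_comp_RLsub (@continuous_jet_scale i j x z z0).
- have c : continuous (fun s : R => (1 - s) * jet i j (x * s) z).
    move=> s; apply: cvgM; last exact: continuous_jet_scale.
    by apply: cvgB; [exact: cvg_cst | exact: cvg_id].
  exact: integrable_comp_RLsub c.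
Qed.

(** Differentiating x^(1 - beta) leaves x^(-beta) times [jetJ]. There [jetJ_ibp] splits off the
    boundary value at u = 0, and the remaining weight [1 - sub] completes the weight [sub], produced
    under the integral sign, to 1. *)
Lemma is_derive_jetI i j (c e a : R) : 0 < a -> 0 < c + e * a ^+ 2 ->
  is_derive a 1 (fun t => jetI i j t (c + e * t ^+ 2))
    (jetI i.+1 j a (c + e * a ^+ 2) + jet i j 0 (c + e * a ^+ 2) * a `^ (- beta)
     + 2 * e * a * jetI i j.+1 a (c + e * a ^+ 2)).
Proof.
move=> a0 z0.
have D1 := is_derive_jetJ i j z0.
have D2 := is_derive1_powR (1 - beta) a0.
have b1 : 1 - beta != 0 by rewrite subr_eq0 gt_eqF.
apply: is_derive_eq.
rewrite subJ// /jetI /GRing.scale/=.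
have -> : 1 - beta - 1 = - beta by ring.
have -> : a `^ (1 - beta) = a * a `^ (- beta).
  by rewrite powRD ?(gt_eqF a0) ?implybT// powRr1// ltW.
rewrite (jetJ_ibp i j a z0); field.
exact: b1.
Qed.

(* [jet i.+2 j] is the (i + 1)-st u-derivative of [2 * u * h j.+1 (u ^+ 2 + z)],
   so the left-hand side is a commutator with multiplication by [x]. *)
Lemma jetI_commutator i j (x z : R) : 0 < x -> 0 < z ->
  jetI i.+2 j x z - 2 * x * jetI i.+1 j.+1 x z =
  2 * (i%:R + beta) * jetI i j.+1 x z + 2 * x * x `^ (- beta) * jet i j.+1 0 z.
Proof.
move=> x0 z0.
have b1 : 1 - beta != 0 by rewrite subr_eq0 gt_eqF.
have xE : x `^ (1 - beta) = x * x `^ (- beta).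
  by rewrite powRD ?(gt_eqF x0) ?implybT// powRr1// ltW.
have E : jetJ i.+2 j x z = 2 * x * (jetJ i.+1 j.+1 x z - onemJ i.+1 j.+1 x z)
    + 2 * i.+1%:R * jetJ i j.+1 x z.
  have i1 : mu.-integrable `[0, 1]
      (EFin \o ((fun s => 2 * x * (s * jet i.+1 j.+1 (x * s) z)) \o sub)).
    apply: integrable_comp_RLsub => // s; apply: cvgMl_tmp.
    by apply: cvgM; [exact: cvg_id | exact: continuous_jet_scale].
  have i2 : mu.-integrable `[0, 1]
      (EFin \o ((fun s => 2 * i.+1%:R * jet i j.+1 (x * s) z) \o sub)).
    apply: integrable_comp_RLsub => // s; apply: cvgMl_tmp.
    exact: continuous_jet_scale.
  have i3 : mu.-integrable `[0, 1] (EFin \o ((fun s => s * jet i.+1 j.+1 (x * s) z) \o sub)).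
    apply: integrable_comp_RLsub => // s; apply: cvgM; first exact: cvg_id.
    exact: continuous_jet_scale.
  have i4 := integrable_comp_RLsub beta_gt0 beta_lt1 (@continuous_jet_scale i j.+1 x z z0).
  rewrite -subJ// /jetJ -RintegralZl// -RintegralZl// -RintegralD//.
  by apply: eq_Rintegral => w _; rewrite jetS; ring.
(* By [jetJ_ibp] the [onemJ] term contributes the boundary value and - 2 (1 - beta) to the
   coefficient 2 (i + 1) of [jetI i j.+1], leaving 2 (i + beta). *)
rewrite /jetI E xE (jetJ_ibp i j.+1 x z0) -natr1; field.
exact: b1.
Qed.

End RL_jets.

(** * Iterated derivatives and their boundary terms at 0 *)

Section RL_derivatives.
Context {R : realType} (h : nat -> R -> R).
Hypothesis Dh : forall j (s : R), 0 < s -> is_derive s 1 (h j) (h j.+1 s).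
Variable beta : R.
Hypotheses (beta_gt0 : 0 < beta) (beta_lt1 : beta < 1).
Notation jet := (jet h).
Notation jetI := (jetI h beta).

(** The m-th derivative of x^(-beta) for x > 0; the boundary terms at u = 0 are multiples of
    these. *)
Definition RLpole (m : nat) (x : R) : R :=
  (\prod_(l < m) (- beta - l%:R)) * x `^ (- beta - m%:R).

Lemma is_derive_RLpole m (x : R) : 0 < x -> is_derive x 1 (RLpole m) (RLpole m.+1 x).
Proof.
move=> x0; have D := is_derive1_powR (- beta - m%:R) x0.
apply: is_derive_eq.
rewrite /RLpole big_ord_recr /= /GRing.scale/= -natr1 opprD addrA; ring.
Qed.

(* The x-derivative of order N of [jetI 0 j], computed by moving derivatives
   under the integral; each of them contributes a boundary term at 0. *)
Definition jetD (N j : nat) (x z : R) : R :=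
  jetI N j x z + \sum_(k < N) jet k j 0 z * RLpole (N.-1 - k) x.

(** The boundary term of [is_derive_jetI] at level N is the new summand k = N of [jetD N.+1], and
    each earlier pole gains one order. *)
Lemma is_derive_jetD N j (c e a : R) : 0 < a -> 0 < c + e * a ^+ 2 ->
  is_derive a 1 (fun t => jetD N j t (c + e * t ^+ 2))
    (jetD N.+1 j a (c + e * a ^+ 2) + 2 * e * a * jetD N j.+1 a (c + e * a ^+ 2)).
Proof.
move=> a0 z0.
have D1 := is_derive_jetI Dh beta_gt0 beta_lt1 N j a0 z0.
have Dz : is_derive a 1 (fun t : R => c + e * t ^+ 2) (2 * e * a).
  by apply: is_derive_eq; rewrite /GRing.scale/=; ring.
have Dk k m : is_derive a 1 (fun t => jet k j 0 (c + e * t ^+ 2) * RLpole m t)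
    (jet k j 0 (c + e * a ^+ 2) * RLpole m.+1 a
     + 2 * e * a * (jet k j.+1 0 (c + e * a ^+ 2) * RLpole m a)).
  have D2 := is_derive_RLpole m a0.
  have D3 := @is_derive_jet _ _ Dh k j (cst 0) (fun t => c + e * t ^+ 2) a _ _ z0
    (is_derive_cst _ _ _) Dz.
  have D4 := is_deriveM D3 D2.
  apply: (is_derive_eq D4).
  rewrite mulr0 add0r /GRing.scale/=; ring.
have D5 : is_derive a 1
    (fun t => \sum_(k < N) jet k j 0 (c + e * t ^+ 2) * RLpole (N.-1 - k) t)
    (\sum_(k < N) (jet k j 0 (c + e * a ^+ 2) * RLpole (N.-1 - k).+1 a
     + 2 * e * a * (jet k j.+1 0 (c + e * a ^+ 2) * RLpole (N.-1 - k) a))).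
  rewrite (_ : (fun t => _) =
      \sum_(k < N) (fun t : R => jet k j 0 (c + e * t ^+ 2) * RLpole (N.-1 - k) t)).
    exact: is_derive_sum.
  by apply/funext => t; rewrite fct_sumE.
apply: (is_derive_eq (is_deriveD D1 D5)).
rewrite /jetD big_split /= -mulr_sumr big_ord_recr /= subnn.
have -> : RLpole 0 a = a `^ (- beta) by rewrite /RLpole big_ord0 mul1r subr0.
have -> : \sum_(k < N) jet k j 0 (c + e * a ^+ 2) * RLpole (N.-1 - k).+1 a =
          \sum_(k < N) jet k j 0 (c + e * a ^+ 2) * RLpole (N - k) a.
  apply: eq_bigr => k _; congr (_ * RLpole _ _).
  by have := ltn_ord k; case: N k {D1 Dk D5} => [|N] k //= kN; rewrite subSn.
ring.
Qed.

Lemma is_derive_jetD_x N j (x z : R) : 0 < x -> 0 < z ->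
  is_derive x 1 (fun t => jetD N j t z) (jetD N.+1 j x z).
Proof.
move=> x0 z0; have := @is_derive_jetD N j z 0 x x0.
rewrite !mul0r !mulr0 !mul0r !addr0 => /(_ z0).
by under eq_fun do rewrite mul0r addr0.
Qed.

(** Differentiating in x reproduces the identity one order higher: the product rule yields an extra
    2 [jetD N.+1 j.+1], which raises N to N + 1 in the coefficient. At N = 0 it is
    [jetI_commutator], whose boundary term cancels against the one inside [jetD 1 j.+1]. *)
Lemma jetD_commutator N j (x z : R) : 0 < x -> 0 < z ->
  jetD N.+2 j x z - 2 * x * jetD N.+1 j.+1 x z =
  h j z * RLpole N.+1 x + 2 * (N%:R + beta) * jetD N j.+1 x z.
Proof.
move=> x0 z0; elim: N x x0 => [|N IH] x x0.
  have C := jetI_commutator Dh beta_gt0 beta_lt1 0 j x0 z0.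
  have j0 i : jet 0 i 0 z = h i z by rewrite /= expr0n /= add0r.
  have j1 i : jet 1 i 0 z = 0 by rewrite /= mulr0 mul0r addr0.
  rewrite /jetD !big_ord_recr !big_ord0 !j0 !j1 !add0r.
  rewrite subn0 subnn.
  have -> : RLpole 0 x = x `^ (- beta) by rewrite /RLpole big_ord0 mul1r subr0.
  have -> : jetI 2 j x z = 2 * (0%:R + beta) * jetI 0 j.+1 x z
      + 2 * x * x `^ (- beta) * h j.+1 z + 2 * x * jetI 1 j.+1 x z.
    by rewrite -j0 -C subrK.
  rewrite addr0 /=; ring.
have D0 := is_derive_jetD_x N.+2 j x0 z0.
have D1 := is_derive_jetD_x N.+1 j.+1 x0 z0.
have D2 := is_derive_jetD_x N j.+1 x0 z0.
have D3 := is_derive_RLpole N.+1 x0.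
pose f t := jetD N.+2 j t z - 2 * t * jetD N.+1 j.+1 t z.
pose g t := h j z * RLpole N.+1 t + 2 * (N%:R + beta) * jetD N j.+1 t z.
have Df : is_derive x 1 f
    (jetD N.+3 j x z - 2 * jetD N.+1 j.+1 x z - 2 * x * jetD N.+2 j.+1 x z).
  by apply: is_derive_eq; rewrite /GRing.scale/=; ring.
have Dg : is_derive x 1 g
    (h j z * RLpole N.+2 x + 2 * (N%:R + beta) * jetD N.+1 j.+1 x z).
  by apply: is_derive_eq; rewrite /GRing.scale/=; ring.
have : 'D_1 f x = 'D_1 g x.
  apply: near_eq_derive; near=> t; apply: IH.
  by near: t; exact: lt_nbhsr.
rewrite !derive_val => E.
rewrite -natr1.
have -> : jetD N.+3 j x z = (jetD N.+3 j x z - 2 * jetD N.+1 j.+1 x z - 2 * x * jetD N.+2 j.+1 x z)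
   + 2 * jetD N.+1 j.+1 x z + 2 * x * jetD N.+2 j.+1 x z by ring.
rewrite E; ring.
Unshelve. all: by end_near. Qed.

(** A formula valid only for x > 0 still determines all derivatives there, since the half-line is
    open. *)
Lemma derive1n_pos (F : nat -> R -> R) (f : R -> R) :
  (forall n (x : R), 0 < x -> is_derive x 1 (F n) (F n.+1 x)) ->
  (forall x, 0 < x -> f x = F 0%N x) ->
  forall n x, 0 < x -> derive1n n f x = F n x.
Proof.
move=> DF f0; elim=> [|n IH] x x0; first exact: f0.
rewrite derive1nS derive1E (@near_eq_derive _ _ _ _ (F n)).
  by have := DF n x x0 => ?; rewrite derive_val.
by near=> t; apply: IH; near: t; exact: lt_nbhsr.
Unshelve. all: by end_near. Qed.

(** The factor [c] will be 1 for Psi and 2 y for its y-derivative. *)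
Lemma derive1n_RL_integral N j (c x z : R) : 0 < x -> 0 < z ->
  derive1n N (RL_integral beta (fun u => c * h j (u ^+ 2 + z))) x = c * jetD N j x z.
Proof.
move=> x0 z0; apply: (@derive1n_pos (fun N x => c * jetD N j x z)) => //.
  move=> n t t0; have D := is_derive_jetD_x n j t0 z0.
  by apply: is_derive_eq.
move=> t t0.
have cj := @continuous_jet _ _ Dh 0 j z z0.
rewrite RL_integralE//; last by move=> u; apply: cvgMl_tmp; exact: cj.
rewrite RintegralZl//; last first.
  exact: (integrable_comp_RLsub beta_gt0 beta_lt1 (@continuous_jet_scale _ _ Dh 0 j t z z0)).
by rewrite /jetD big_ord0 addr0 /jetI mulrCA.
Qed.

(** With e = -1 the total derivative along the circle is the left-hand side of [jetD_commutator]. *)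
Lemma is_derive_jetD_circle N j (r2 a : R) : 0 < a -> 0 < r2 - a ^+ 2 ->
  is_derive a 1 (fun t => jetD N.+1 j t (r2 - t ^+ 2))
    (h j (r2 - a ^+ 2) * RLpole N.+1 a +
     2 * (N%:R + beta) * jetD N j.+1 a (r2 - a ^+ 2)).
Proof.
move=> a0 z0; rewrite -jetD_commutator//.
have := @is_derive_jetD N.+1 j r2 (-1) a a0; rewrite mulN1r => /(_ z0).
under eq_fun do rewrite mulN1r.
by rewrite mulrN1 !mulNr.
Qed.

End RL_derivatives.

(** * First-order expansion along a rotation *)

Section first_order.
Context {R : realType}.

Lemma derivable_near_lipschitz (g : R -> R) (a : R) : derivable g a 1 ->
  exists2 K : R, 0 < K & \forall t \near (0 : R), `|g (a + t) - g a| <= K * `|t|.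
Proof.
move=> Dg; pose l := 'D_1 g a.
have cg : h^-1 *: (g (h *: 1 + a) - g a) @[h --> (0 : R)^'] --> l by exact: Dg.
exists (`|l| + 1); first by rewrite ltr_wpDl.
move/cvgrPdist_lt : cg => /(_ 1 ltr01) [r /= r0 rb].
exists r => //= t tr.
have [->|t0] := eqVneq t 0; first by rewrite addr0 subrr !normr0 mulr0.
have /= := rb t tr t0; rewrite /GRing.scale/= mulr1 (addrC t a) => lt1.
have -> : g (a + t) - g a = (t^-1 * (g (a + t) - g a)) * t.
  by rewrite mulrAC mulVf// mul1r.
rewrite normrM ler_wpM2r//.
rewrite -(subrK l (t^-1 * _)) (le_trans (ler_normD _ _))// addrC lerD2l distrC.
exact: ltW.
Qed.

(** Differentiability of [df] at the single point 0 replaces a second-order Taylor formula: the mean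
    value theorem for f t - t * df 0 gives an error (df c - df 0) t with c between 0 and t, and the
    Lipschitz bound at 0 makes it at most K t^2. *)
Lemma first_order_expansion (f df : R -> R) :
  (\forall t \near (0 : R), is_derive (t : R) 1 f (df t)) -> derivable df 0 1 ->
  (fun t => f t - (f 0 + t * df 0)) =O_ (nbhs (0 : R)) (fun t => t ^+ 2).
Proof.
move=> Df Ddf; have [K K0 lip] := derivable_near_lipschitz Ddf.
have [r /= r0 rb] : \forall t \near (0 : R),
    is_derive (t : R) 1 f (df t) /\ `|df (0 + t) - df 0| <= K * `|t|.
  by near=> t; split; near: t.
have {}rb (t : R) : `|t| < r -> is_derive t 1 f (df t) /\ `|df t - df 0| <= K * `|t|.
  by move=> tr; have := rb t; rewrite /= sub0r normrN add0r => /(_ tr).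
pose g (t : R) := f t - t * df 0.
have Dg (t : R) : `|t| < r -> is_derive t 1 g (df t - df 0).
  by move=> /rb[D _]; apply: is_derive_eq; rewrite /GRing.scale/=; ring.
have cg (a b : R) : (forall t : R, a <= t <= b -> `|t| < r) -> {within `[a, b], continuous g}.
  move=> ab; apply: continuous_in_subspaceT => t; rewrite inE/= in_itv/= => /ab tr.
  exact: is_derive1_cvg (Dg _ tr).
have mvt (a b : R) : a < b -> (forall t : R, a <= t <= b -> `|t| < r) ->
    exists2 c, a < c < b & g b - g a = (df c - df 0) * (b - a).
  move=> ab h.
  have Dab t : t \in `]a, b[ -> is_derive t 1 g (df t - df 0).
    by rewrite in_itv/= => /andP[at_ tb]; apply: Dg; apply: h; rewrite !ltW.
  have [c cab E] := MVT ab Dab (cg _ _ h).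
  by exists c => //; move: cab; rewrite in_itv.
apply/eqO_exP; exists K => //; exists r => //= t.
rewrite /= sub0r normrN => tr.
have -> : f t - (f 0 + t * df 0) = g t - g 0 by rewrite /g; ring.
rewrite normrX expr2 mulrA.
have [t0|t0|->] := ltgtP t 0; last by rewrite subrr normr0 mulr0.
- have h s : t <= s <= 0 -> `|s| < r.
    by move=> /andP[ts s0]; rewrite (le_lt_trans _ tr)// !ler0_norm// ?lerN2// ltW.
  have [c /andP[tc c0] E] := mvt _ _ t0 h.
  rewrite -normrN opprB E normrM sub0r normrN ler_wpM2r//.
  have cr : `|c| < r by apply: h; rewrite !ltW.
  have [_ /le_trans] := rb c cr; apply.
  by rewrite ler_pM2l// !ltr0_norm// lerN2 ltW.
- have h s : 0 <= s <= t -> `|s| < r.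
    by move=> /andP[s0 st]; rewrite (le_lt_trans _ tr)// !ger0_norm// ltW.
  have [c /andP[c0 ct] E] := mvt _ _ t0 h.
  rewrite E normrM subr0 ler_wpM2r//.
  have cr : `|c| < r by apply: h; rewrite !ltW.
  have [_ /le_trans] := rb c cr; apply.
  by rewrite ler_pM2l// !gtr0_norm// ltW.
Unshelve. all: by end_near. Qed.

Lemma is_derive_rot_x (phi x y : R) :
  is_derive phi 1 (fun p => rot_x p x y) (rot_y phi x y).
Proof.
rewrite /rot_x /rot_y; apply: is_derive_eq; rewrite /GRing.scale/=; ring.
Qed.

Lemma is_derive_rot_y (phi x y : R) :
  is_derive phi 1 (fun p => rot_y p x y) (- rot_x phi x y).
Proof.
rewrite /rot_x /rot_y; apply: is_derive_eq; rewrite /GRing.scale/=; ring.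
Qed.

Lemma rot_x0 (x y : R) : rot_x 0 x y = x.
Proof. by rewrite /rot_x cos0 sin0 mul1r mul0r addr0. Qed.

Lemma rot_y0 (x y : R) : rot_y 0 x y = y.
Proof. by rewrite /rot_y cos0 sin0 oppr0 mul1r mul0r add0r. Qed.

Lemma rot_norm (phi x y : R) :
  rot_x phi x y ^+ 2 + rot_y phi x y ^+ 2 = x ^+ 2 + y ^+ 2.
Proof.
rewrite /rot_x /rot_y; have := cos2Dsin2 phi.
set c := cos phi; set s := sin phi => cs.
transitivity ((c ^+ 2 + s ^+ 2) * (x ^+ 2 + y ^+ 2)); first by ring.
by rewrite cs mul1r.
Qed.

(** The angular derivative of x' is y', which equals y at angle 0; this is the source of the factor
    y. *)
Lemma first_order_expansion_rot (M dM : R -> R) (x y : R) :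
  (\forall t \near x, is_derive (t : R) 1 M (dM t)) -> derivable dM x 1 ->
  (fun phi => M (rot_x phi x y) - (M x + phi * (y * dM x)))
    =O_ (nbhs (0 : R)) (fun phi => phi ^+ 2).
Proof.
move=> DM DdM.
have Dx := is_derive_rot_x 0 x y; have Dy := is_derive_rot_y 0 x y.
have := @first_order_expansion (fun p => M (rot_x p x y))
  (fun p => rot_y p x y * dM (rot_x p x y)).
rewrite rot_x0 rot_y0; apply.
- have cx : rot_x p x y @[p --> (0 : R)] --> x.
    by rewrite -[X in _ --> X](rot_x0 x y); exact: is_derive1_cvg Dx.
  have DM' : \forall p \near (0 : R), is_derive (rot_x (p : R) x y) 1 M (dM (rot_x p x y)).
    exact: cx DM.
  near=> p.
  have Dp : is_derive (rot_x p x y) 1 M (dM (rot_x p x y)) by near: p.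
  have D := @is_derive1_comp _ M (fun p => rot_x p x y) p _ _ Dp (is_derive_rot_x p x y).
  by apply: (is_derive_eq D); rewrite mulrC.
- have DM' : is_derive (rot_x 0 x y) 1 dM ('D_1 dM x) by rewrite rot_x0; exact: derivableP.
  have D := @is_derive1_comp _ dM (fun p => rot_x p x y) 0 _ _ DM' Dx.
  by have := is_deriveM Dy D => ?; exact: ex_derive.
Unshelve. all: by end_near. Qed.

End first_order.

(** * Expansion of the derivatives of a rotation invariant function *)

Section rotation_expansion.
Context {R : realType} (Psi : R -> R -> R).
Hypotheses (hana : real_analytic2 Psi) (hrot : rotation_invariant Psi).
Notation h := (profile Psi).

Let Dh := is_derive_profile hana.

Lemma slice_profile (y : R) : (fun u => Psi u y) = (fun u => h 0 (u ^+ 2 + y ^+ 2)).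
Proof. by apply/funext => u; rewrite (profileE hrot). Qed.

(** Stated for every u because the fractional integral sees all of [0, x]; y > 0 keeps u^2 + y^2
    positive even at u = 0. *)
Lemma partial_y_profile (y : R) : 0 < y ->
  (fun u => partial_y Psi u y) = (fun u => 2 * y * h 1 (u ^+ 2 + y ^+ 2)).
Proof.
move=> y0; apply/funext => u; rewrite /partial_y.
have -> : (fun w => Psi u w) = h 0 \o (fun w => u ^+ 2 + w ^+ 2).
  by apply/funext => w; rewrite (profileE hrot).
have D1 : is_derive y 1 (fun w : R => u ^+ 2 + w ^+ 2) (2 * y).
  by apply: is_derive_eq; rewrite /GRing.scale/=; ring.
have D2 := Dh 0 (ltr_wpDl (sqr_ge0 u) (exprn_gt0 2 y0)).
have D := @is_derive1_comp _ (h 0) (fun w => u ^+ 2 + w ^+ 2) y _ _ D2 D1.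
by rewrite derive1E derive_val mulrC.
Qed.

Lemma eqO_near_eq (f g e : R -> R) : (\forall t \near (0 : R), f t = g t) ->
  g =O_ (nbhs (0 : R)) e -> f =O_ (nbhs (0 : R)) e.
Proof.
move=> fg /eqO_exP[k k0 gk]; apply/eqO_exP; exists k => //.
near=> t; have -> : f t = g t by near: t.
by near: t.
Unshelve. all: by end_near. Qed.

Lemma near_rot_gt0 (x y : R) : 0 < x -> 0 < y ->
  \forall p \near (0 : R), 0 < rot_x p x y /\ 0 < rot_y p x y.
Proof.
move=> x0 y0.
have cx : rot_x p x y @[p --> (0 : R)] --> x.
  by rewrite -[X in _ --> X](rot_x0 x y); exact: is_derive1_cvg (is_derive_rot_x 0 x y).
have cy : rot_y p x y @[p --> (0 : R)] --> y.
  by rewrite -[X in _ --> X](rot_y0 x y); exact: is_derive1_cvg (is_derive_rot_y 0 x y).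
by near=> p; split; near: p; [exact: (cvgr_gt x)|exact: (cvgr_gt y)].
Unshelve. all: by end_near. Qed.

Lemma rot_y_sqr (p x y : R) :
  rot_y p x y ^+ 2 = (x ^+ 2 + y ^+ 2) - rot_x p x y ^+ 2.
Proof. by rewrite -(rot_norm p) addrAC subrr add0r. Qed.

Section fractional_order.
Variable alpha : R.
Hypotheses (alpha_gt0 : 0 < alpha) (alpha_nat : alpha \isn't a Num.nat).
(** Integer and fractional part of [alpha]: the kernel exponent is [beta] and the Gamma factor is
    that of 1 - beta, for the orders alpha and alpha - 1 alike. *)
Let N := Num.truncn alpha.
Let beta : R := alpha - N%:R.
Let G : R := Gamma (N.+1%:R - alpha).

Let beta_gt0 : 0 < beta.
Proof.
have /andP[Na _] := truncn_itv (ltW alpha_gt0).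
rewrite subr_gt0 lt_neqAle Na andbT; apply: contra alpha_nat => /eqP <-.
exact: natr_nat.
Qed.

Let beta_lt1 : beta < 1.
Proof. by have /andP[_] := truncn_itv (ltW alpha_gt0); rewrite ltrBlDr nat1r. Qed.

Lemma RL_deriv_x_profile (x y : R) : 0 < x -> 0 < y ->
  RL_deriv_x alpha Psi x y = G^-1 * jetD h beta N.+1 0 x (y ^+ 2).
Proof.
move=> x0 y0; rewrite /RL_deriv_x /RL_deriv ltNge ltW//= (negbTE alpha_nat).
rewrite -/N -/G slice_profile; congr (_ * _).
have -> : alpha - N.+1%:R + 1 = beta by rewrite /beta -natr1; ring.
have := derive1n_RL_integral Dh beta_gt0 beta_lt1 N.+1 0 1 x0 (exprn_gt0 2 y0).
by rewrite mul1r; under eq_fun do rewrite mul1r.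
Qed.

(** For alpha < 1 the order alpha - 1 means a fractional integral, for alpha > 1 an N-th derivative
    of one; [jetD N] covers both since N = 0 in the first case. *)
Lemma RL_deriv_x_partial_y_profile (x y : R) : 0 < x -> 0 < y ->
  RL_deriv_x (alpha - 1) (partial_y Psi) x y =
  G^-1 * (2 * y * jetD h beta N 1 x (y ^+ 2)).
Proof.
move=> x0 y0; rewrite /RL_deriv_x partial_y_profile//.
have D n := derive1n_RL_integral Dh beta_gt0 beta_lt1 n 1 (2 * y) x0 (exprn_gt0 2 y0).
have /andP[Na aN] := truncn_itv (ltW alpha_gt0).
rewrite -/N in Na aN; rewrite /RL_deriv.
have [a1|a1] := ltP (alpha - 1) 0.
  have N0 : N = 0%N by apply: truncn_def; rewrite ltW//= -subr_lt0.
  have -> : 1 + (alpha - 1) = beta by rewrite /beta N0; ring.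
  rewrite opprB /G N0; congr (_ * _); exact: D 0%N.
have [n Nn] : exists n, N = n.+1.
  by exists N.-1; rewrite prednK// truncn_gt0 -subr_ge0.
have an : alpha - 1 \isn't a Num.nat.
  apply: contra alpha_nat => /natrP[m am]; apply/natrP; exists m.+1.
  by rewrite -natr1 -am subrK.
have -> : Num.truncn (alpha - 1) = n.
  by apply: truncn_def; rewrite lerBrDr ltrBlDr !natr1 -Nn Na.
rewrite (negbTE an) -Nn -D /G; congr (_ * derive1n _ (RL_integral _ _) _).
  by congr (Gamma _)^-1; rewrite -natr1; ring.
by rewrite /beta; ring.
Qed.

(** At - alpha the extension of Gamma takes N + 1 steps, and its denominator is the product in
    [RLpole]. *)
Lemma RLpole_Gamma (x : R) : x `^ (- alpha - 1) / Gamma (- alpha) = G^-1 * RLpole beta N.+1 x.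
Proof.
have aN : alpha < N.+1%:R by exact: truncnS_gt.
rewrite /G /Gamma oppr_gt0 ltNge (ltW alpha_gt0)/= opprK -/N subr_gt0 aN.
rewrite invf_div mulrA [RHS]mulrC; congr (_ / _); last by rewrite addrC.
rewrite mulrC /RLpole; congr (_ * _ `^ _); last by rewrite /beta -natr1; ring.
(* Reversing the index turns - alpha + (N - k) into - beta - k. *)
rewrite (reindex_inj rev_ord_inj) /=; apply: eq_bigr => k _.
rewrite subSS natrB ?leq_ord// /beta; ring.
Qed.

Lemma fractional_expansion_x (x y : R) : 0 < x -> 0 < y ->
  (fun phi : R => RL_deriv_x alpha Psi (rot_x phi x y) (rot_y phi x y)
     - (RL_deriv_x alpha Psi x y
        + phi * (alpha * RL_deriv_x (alpha - 1) (partial_y Psi) x y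
                 + y * Psi 0 y * x `^ (- alpha - 1) / Gamma (- alpha))))
    =O_ (nbhs (0 : R)) (fun phi : R => phi ^+ 2).
Proof.
move=> x0 y0; set r2 := x ^+ 2 + y ^+ 2.
have zE : r2 - x ^+ 2 = y ^+ 2 by rewrite /r2 addrAC subrr add0r.
have z0 : 0 < r2 - x ^+ 2 by rewrite zE exprn_gt0.
(* As y'^2 = r2 - x'^2 along the orbit, the rotated derivative is [M] at x'. *)
pose M t := G^-1 * jetD h beta N.+1 0 t (r2 - t ^+ 2).
pose dM t := G^-1 * (h 0 (r2 - t ^+ 2) * RLpole beta N.+1 t +
     2 * (N%:R + beta) * jetD h beta N 1 t (r2 - t ^+ 2)).
have Dz : is_derive x 1 (fun t : R => r2 - t ^+ 2) (- (2 * x)).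
  by apply: is_derive_eq; rewrite /GRing.scale/=; ring.
apply: (eqO_near_eq _ (@first_order_expansion_rot _ M dM x y _ _)).
- near=> p.
  have [X0 Y0] : 0 < rot_x p x y /\ 0 < rot_y p x y by near: p; exact: near_rot_gt0.
  rewrite RL_deriv_x_profile// RL_deriv_x_profile// RL_deriv_x_partial_y_profile//.
  rewrite rot_y_sqr -/r2 /M zE; congr (_ - (_ + _ * _)).
  rewrite /dM zE -(mulrA (y * _)) RLpole_Gamma (profileE hrot) expr0n /= add0r.
  (* The commutator coefficient gives the factor alpha; the remaining 2 y belongs to the
     y-derivative of Psi. *)
  have -> : N%:R + beta = alpha by rewrite addrC subrK.
  ring.
- near=> t.
  have t0 : 0 < t by near: t; exact: lt_nbhsr.
  have zt : 0 < r2 - t ^+ 2 by near: t; exact: (cvgr_gt _ (is_derive1_cvg Dz)).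
  have D := is_derive_jetD_circle Dh beta_gt0 beta_lt1 N 0 t0 zt.
  by apply: is_derive_eq.
- have D1 := @is_derive1_comp _ (h 0) (fun t => r2 - t ^+ 2) x _ _ (Dh 0 z0) Dz.
  have D2 := is_derive_RLpole beta N.+1 x0.
  have D3 := @is_derive_jetD _ _ Dh _ beta_gt0 beta_lt1 N 1 r2 (-1) x x0.
  rewrite mulN1r in D3.
  have {}D3 : derivable (fun t => jetD h beta N 1 t (r2 - t ^+ 2)) x 1.
    have := D3 z0; under eq_fun do rewrite mulN1r.
    by move=> ?; exact: ex_derive.
  rewrite /dM; apply: derivableM; first exact: derivable_cst.
  apply: derivableD; last by apply: derivableM; [exact: derivable_cst | exact: D3].
  by apply: derivableM; exact: ex_derive.
Unshelve. all: by end_near. Qed.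

End fractional_order.

Section integer_order.
Variable N : nat.

Lemma derive1n_jet (c : R) j n (x z : R) : 0 < x -> 0 < z ->
  derive1n n (fun u => c * h j (u ^+ 2 + z)) x = c * jet h n j x z.
Proof.
move=> x0 z0; apply: (@derive1n_pos _ (fun n u => c * jet h n j u z)) => // m t _.
by have := is_derive_jet_x Dh m j t z0 => ?; apply: is_derive_eq.
Qed.

(** No integral occurs: [M] is a plain jet, and the pole term disappears through 1 / Gamma = 0. *)
Lemma integer_expansion_x (x y : R) : 0 < x -> 0 < y ->
  (fun phi : R => RL_deriv_x N.+1%:R Psi (rot_x phi x y) (rot_y phi x y)
     - (RL_deriv_x N.+1%:R Psi x y
        + phi * (N.+1%:R * RL_deriv_x (N.+1%:R - 1) (partial_y Psi) x y
                 + y * Psi 0 y * x `^ (- N.+1%:R - 1) / Gamma (- N.+1%:R))))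
    =O_ (nbhs (0 : R)) (fun phi : R => phi ^+ 2).
Proof.
move=> x0 y0; set r2 := x ^+ 2 + y ^+ 2.
have zE : r2 - x ^+ 2 = y ^+ 2 by rewrite /r2 addrAC subrr add0r.
have z0 : 0 < r2 - x ^+ 2 by rewrite zE exprn_gt0.
have RLE n (f : R -> R) : RL_deriv n%:R f = derive1n n f.
  by apply/funext => t; rewrite /RL_deriv ltNge ler0n/= natr_nat natrK.
have RL1 (X Y : R) : 0 < X -> 0 < Y ->
    RL_deriv_x N.+1%:R Psi X Y = jet h N.+1 0 X (Y ^+ 2).
  move=> X0 Y0; rewrite /RL_deriv_x RLE slice_profile.
  have := derive1n_jet 1 0 N.+1 X0 (exprn_gt0 2 Y0).
  by rewrite mul1r; under eq_fun do rewrite mul1r.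
have RL2 : RL_deriv_x (N.+1%:R - 1) (partial_y Psi) x y = 2 * y * jet h N 1 x (y ^+ 2).
  rewrite -natr1 addrK /RL_deriv_x RLE partial_y_profile//.
  exact: derive1n_jet x0 (exprn_gt0 2 y0).
(* The last factor of the product, k = N + 1, is zero, and division by zero gives 0. *)
have Gamma0 : Gamma (- N.+1%:R : R) = 0.
  rewrite /Gamma oppr_gt0 ltNge ler0n/= opprK natrK big_ord_recr /= addNr mulr0.
  by rewrite invr0 mulr0.
pose M t := jet h N.+1 0 t (r2 - t ^+ 2).
pose dM t := 2 * N.+1%:R * jet h N 1 t (r2 - t ^+ 2).
have Dz (t : R) : is_derive t 1 (fun t : R => r2 - t ^+ 2) (- (2 * t)).
  by apply: is_derive_eq; rewrite /GRing.scale/=; ring.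
have Dj n j (t : R) : 0 < r2 - t ^+ 2 ->
    is_derive t 1 (fun t => jet h n j t (r2 - t ^+ 2))
      (jet h n.+1 j t (r2 - t ^+ 2) - 2 * t * jet h n j.+1 t (r2 - t ^+ 2)).
  move=> zt; have D := @is_derive_jet _ _ Dh n j id (fun t => r2 - t ^+ 2) t _ _ zt
    (is_derive_id _ _) (Dz t).
  by apply: (is_derive_eq D); ring.
apply: (eqO_near_eq _ (@first_order_expansion_rot _ M dM x y _ _)).
- near=> p.
  have [X0 Y0] : 0 < rot_x p x y /\ 0 < rot_y p x y by near: p; exact: near_rot_gt0.
  rewrite !RL1// RL2 Gamma0 invr0 mulr0 addr0 rot_y_sqr -/r2 /M /dM zE; ring.
- near=> t.
  have zt : 0 < r2 - t ^+ 2 by near: t; exact: (cvgr_gt _ (is_derive1_cvg (Dz x))).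
  have D := Dj N.+1 0%N t zt; apply: (is_derive_eq D).
  (* The term of [jetS] with factor 2 t cancels the contribution of D_z, leaving 2 (N + 1) times the
     jet of order N. *)
  by rewrite jetS addrAC subrr add0r.
- have D := Dj N 1%N x z0.
  by apply: derivableM; [exact: derivable_cst | exact: ex_derive].
Unshelve. all: by end_near. Qed.

End integer_order.

Lemma rotation_expansion_x (alpha x y : R) : 0 < alpha -> 0 < x -> 0 < y ->
  (fun phi : R => RL_deriv_x alpha Psi (rot_x phi x y) (rot_y phi x y)
     - (RL_deriv_x alpha Psi x y
        + phi * (alpha * RL_deriv_x (alpha - 1) (partial_y Psi) x y
                 + y * Psi 0 y * x `^ (- alpha - 1) / Gamma (- alpha))))
    =O_ (nbhs (0 : R)) (fun phi : R => phi ^+ 2).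
Proof.
move=> a0 x0 y0; have [/natrP[[|N] aN]|an] := boolP (alpha \is a Num.nat).
- by rewrite aN ltxx in a0.
- by rewrite aN; exact: integer_expansion_x.
- exact: fractional_expansion_x.
Qed.

End rotation_expansion.

Theorem mainTheorem3 (R : realType) (alpha : R) (Psi : R -> R -> R)
    (halpha : 0 < alpha)
    (hana : real_analytic2 Psi)
    (hrot : rotation_invariant Psi)
    (x y : R) (hx : 0 < x) (hy : 0 < y) :
  (fun phi : R => RL_deriv_x alpha Psi (rot_x phi x y) (rot_y phi x y)
     - (RL_deriv_x alpha Psi x y
        + phi * (alpha * RL_deriv_x (alpha - 1) (partial_y Psi) x y
                 + y * Psi 0 y * x `^ (- alpha - 1) / Gamma (- alpha))))
    =O_ (nbhs (0 : R)) (fun phi : R => phi ^+ 2)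
  /\
  (fun phi : R => RL_deriv_y alpha Psi (rot_x phi x y) (rot_y phi x y)
     - (RL_deriv_y alpha Psi x y
        - phi * (alpha * RL_deriv_y (alpha - 1) (partial_x Psi) x y
                 + x * Psi x 0 * y `^ (- alpha - 1) / Gamma (- alpha))))
    =O_ (nbhs (0 : R)) (fun phi : R => phi ^+ 2).
Proof.
split; first exact: rotation_expansion_x.
have swap : Psi = fun u v => Psi v u.
  by apply/funext => u; apply/funext => v; exact: rotation_invariant_swap.
have RLy a (f : R -> R -> R) u v : RL_deriv_y a f u v = RL_deriv_x a (fun s t => f t s) v u.
  by [].
have px : (fun s t => partial_x Psi t s) = partial_y Psi.
  by apply/funext => s; apply/funext => t; rewrite /partial_x /partial_y {1}swap.
have rx p : rot_x p x y = rot_y (- p) y x.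
  by rewrite /rot_x /rot_y cosN sinN opprK addrC.
have ry p : rot_y p x y = rot_x (- p) y x.
  by rewrite /rot_x /rot_y cosN sinN addrC.
have /eqO_exP[k k0 [r r0 rb]] := rotation_expansion_x hana hrot halpha hy hx.
(* Constant and radius for (y, x) carry over, since the ball and phi^2 are invariant under a change
   of sign of phi. *)
apply/eqO_exP; exists k => //; exists r => // p pr.
have {}pr : ball_ Num.norm 0 r (- p) by move: pr; rewrite /= !sub0r !normrN.
have := rb _ pr; rewrite /= sqrrN rx ry !RLy -swap px (_ : Psi x 0 = Psi 0 x);
  last exact: rotation_invariant_swap.
by rewrite mulNr.
Qed.
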